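(* Let $\Gamma$ be a groupoid and let $R=\bigoplus_{\gamma\in\Gamma}R_\gamma$ be a $\Gamma$-graded ring. The following statements are equivalent. (1) $R$ is a gr-simple $\Gamma_0$-artinian ring. (2) There exist $e\in\Gamma_0$, a $\Gamma$-graded division ring $D$ with $\operatorname{supp}(D)\subseteq e\Gamma e$ and a $d$-finite sequence $\overline{\sigma}=(\sigma_i)_{i\in I}\in(e\Gamma)^I$ such that $R\cong_{gr}\mathrm{M}_I(D)(\overline{\sigma})$. (3) There exist a gr-prime $\Gamma$-graded division ring $D$ and a matricial sequence $\overline{\Sigma}=(\Sigma_i)_{i\in I}\in\mathcal{P}(\Gamma)^I$ for $D$ such that $R\cong_{gr}\mathrm{M}_I(D)(\overline{\Sigma})$. (4) There exist a $\Gamma$-graded division ring $D$ with $\operatorname{supp}(D)\subseteq e\Gamma e$ for some $e\in\Gamma_0$ and a $\Gamma$-graded right $D$-module $V$ which is $\Gamma_0$-finite dimensional over $D$ such that $R\cong_{gr}\mathrm{END}_D(V)$. (5) There exist a gr-prime $\Gamma$-graded division ring $D$ and a $\Gamma$-graded right $D$-module $V$ which is $\Gamma_0$-finite dimensional over $D$ such that $R\cong_{gr}\mathrm{END}_D(V)$.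
   Context: A groupoid $\Gamma$ is a small category with all morphisms invertible, identified with its set of morphisms; $\Gamma_0$ is its set of objects (identified with identity morphisms). For $\gamma:e\to f$ write $d(\gamma)=e$, $r(\gamma)=f$; $\delta\gamma$ is defined iff $d(\delta)=r(\gamma)$. $e\Gamma=\{\gamma:r(\gamma)=e\}$, $e\Gamma f=\{\gamma:r(\gamma)=e,d(\gamma)=f\}$. $\mathcal{P}(\Gamma)$ is the power set of $\Gamma$. A $\Gamma$-graded ring is an associative ring $R=\bigoplus_{\gamma\in\Gamma}R_\gamma$ (additive subgroups) with $R_\gamma R_\delta\subseteq R_{\gamma\delta}$ if $\gamma\delta$ is defined and $R_\gamma R_\delta=0$ otherwise (generally, homogeneous components indexed by undefined products are $\{0\}$), always assumed object unital: for each $e\in\Gamma_0$, $R_e$ is a unital ring with identity $1_e$ (possibly $1_e=0$) and $1_{r(\gamma)}a=a=a1_{d(\gamma)}$ for $a\in R_\gamma$. $R$ need not be unital. $\operatorname{supp}(R)=\{\gamma:R_\gamma\neq0\}$, $\Gamma_0'(R)=\{e\in\Gamma_0:1_e\ne0\}$. $\cong_{gr}$ between rings means there is a degree-preserving ring isomorphism. Graded (right, two-sided) ideals are those that are sums of their intersections with the $R_\gamma$. A $\Gamma$-graded $R$-module is a right $R$-module $M=\bigoplus_\gamma M_\gamma$ with $M_\gamma R_\delta\subseteq M_{\gamma\delta}$ (zero if undefined) and $MR=M$. For $e\in\Gamma_0$, $M(e):=\bigoplus_{r(\gamma)=e}M_\gamma$, a graded submodule. $R$ is gr-simple if $R\ne0$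 and its only graded ideals are $0$ and $R$; gr-prime if $IJ\ne0$ for all nonzero graded ideals $I,J$. $R$ is $\Gamma_0$-artinian if, for each $e\in\Gamma_0$, $R(e)=1_eR$ satisfies the descending chain condition on graded right submodules (for gr-simple rings this is left-right symmetric). A $\Gamma$-graded division ring is a $\Gamma$-graded ring $D\neq0$ such that each nonzero $a\in D_\gamma$ has $a^{-1}\in D_{\gamma^{-1}}$ with $aa^{-1}=1_{r(\gamma)}$, $a^{-1}a=1_{d(\gamma)}$. Every $\Gamma$-graded right module $M$ over a $\Gamma$-graded division ring $D$ has a pseudo-basis, i.e. a sequence of nonzero homogeneous elements $x_i\in M_{\gamma_i}$ $(i\in I)$ generating $M$ such that $\sum x_ia_i=0$ with $(a_i)\in\bigoplus_i1_{d(\gamma_i)}D$ implies all $a_i=0$; its cardinality is uniquely determined and called the pseudo-dimension of $M$. $V$ is $\Gamma_0$-finite dimensional over $D$ if $V(f)$ has finite pseudo-dimension for every $f\in\Gamma_0$. $\mathrm{END}_D(V)=\bigoplus_{\gamma}\mathrm{END}_D(V)_\gamma$, where $\mathrm{END}_D(V)_\gamma$ is the group of $D$-module endomorphisms $g$ with $g(V_\sigma)\subseteq V_{\gamma\sigma}$ for all $\sigma$ (with $V_{\gamma\sigma}=0$ if $\gamma\sigma$ is undefined); it is a $\Gamma$-graded ring under composition. All index sets of matrix rings are non-empty. A sequence $(\sigma_i)_{i\in I}\in\Gamma^I$ is $d$-finite if for each $f\in\Gamma_0$ only finitely many $i$ satisfy $d(\sigma_i)=f$. A sequence $\overline{\Sigma}=(\Sigma_i)_{i\in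 I}$ of non-empty subsets of $\Gamma$ is matricial for $D$ if: for each $i$ and each $f\in\Gamma_0$ there is at most one $\sigma\in\Sigma_i$ with $d(\sigma)=f$ and at most one $\sigma\in\Sigma_i$ with $r(\sigma)=f$; $r(\sigma)\in\Gamma_0'(D)$ for all $\sigma\in\Sigma_i$; and for each $f\in\Gamma_0$ the set of $i$ such that some $\sigma\in\Sigma_i$ has $d(\sigma)=f$ is finite. Then $\mathrm{M}_I(D)(\overline{\Sigma})$ is the $\Gamma$-graded ring $\bigoplus_\gamma\mathrm{M}_I(D)(\overline{\Sigma})_\gamma$ (with matrix multiplication), where $\mathrm{M}_I(D)(\overline{\Sigma})_\gamma$ is the set of $I\times I$ matrices over $D$ with finitely many nonzero entries whose $(i,j)$ entry lies in $D_{\Sigma_i\gamma\Sigma_j^{-1}}$; here $D_{\Sigma_i\gamma\Sigma_j^{-1}}:=D_{\sigma\gamma\tau^{-1}}$ if there are (unique) $\sigma\in\Sigma_i,\tau\in\Sigma_j$ with $d(\sigma)=r(\gamma)$, $d(\tau)=d(\gamma)$, and $\{0\}$ otherwise. A sequence $\overline{\sigma}=(\sigma_i)$ of elements is treated as the sequence of singletons $\{\sigma_i\}$.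
   Formalization: In (4) and (5) the module V is required to be nonzero; with V = 0 allowed, R = 0 would satisfy (4) and (5) but not (1), since a gr-simple ring is nonzero. *)

(* Defs.v *)
From HB Require Import structures.
From mathcomp Require Import all_boot all_algebra.
From mathcomp Require Import boolp classical_sets functions cardinality fsbigop.

Set Implicit Arguments.
Unset Strict Implicit.
Unset Printing Implicit Defensive.
Import GRing.Theory.
Local Open Scope classical_set_scope.
Local Open Scope ring_scope.

(* A groupoid is given by its set of morphisms, with [src] and [tgt] playing
   the roles of d and r, and the objects embedded by [idn].  The composition
   [gcomp g h] (first h, then g) is a total function that is only meaningful
   when [src g = tgt h]; its other values are never used. *)
Record groupoid := Groupoid {
  obj : Type;
  arr :> Type;
  src : arr -> obj;
  tgt : arr -> obj;
  idn : obj -> arr;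
  gcomp : arr -> arr -> arr;
  ginv : arr -> arr;
  src_idn : forall e, src (idn e) = e;
  tgt_idn : forall e, tgt (idn e) = e;
  src_comp : forall g h, src g = tgt h -> src (gcomp g h) = src h;
  tgt_comp : forall g h, src g = tgt h -> tgt (gcomp g h) = tgt g;
  gcompA : forall g h k, src g = tgt h -> src h = tgt k ->
    gcomp g (gcomp h k) = gcomp (gcomp g h) k;
  gcomp_idr : forall g, gcomp g (idn (src g)) = g;
  gcomp_idl : forall g, gcomp (idn (tgt g)) g = g;
  src_inv : forall g, src (ginv g) = tgt g;
  tgt_inv : forall g, tgt (ginv g) = src g;
  gcompV : forall g, gcomp g (ginv g) = idn (tgt g);
  gcompVg : forall g, gcomp (ginv g) g = idn (src g) }.

Arguments src {_} _.
Arguments tgt {_} _.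
Arguments idn {_} _.
Arguments gcomp {_} _ _.
Arguments ginv {_} _.

Definition finite_support (T : Type) (A : zmodType) (a : T -> A) : Prop :=
  finite_set [set t | a t <> 0].

(* Meaningful for families with finite support ([fsum a = 0] otherwise). *)
Definition fsum (T : Type) (A : zmodType) (a : T -> A) : A :=
  \sum_(t \in [set: {classic T}]) a t.

Definition subgroup (A : zmodType) (S : set A) : Prop :=
  S 0 /\ forall x y, S x -> S y -> S (x - y).

Definition addspan (A : zmodType) (X : set A) : set A :=
  smallest (@subgroup A) X.

Definition independent (T : Type) (A : zmodType) (C : T -> set A) : Prop :=
  forall a : T -> A, finite_support a -> (forall t, C t (a t)) ->
    fsum a = 0 -> forall t, a t = 0.

Definition direct_sum (T : Type) (A : zmodType) (C : T -> set A) : Prop :=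
  [/\ forall t, subgroup (C t),
      independent C &
      addspan (\bigcup_t C t) = setT].

(* [N] is the sum of its intersections with the members of the family [C]. *)
Definition graded_set (T : Type) (A : zmodType) (C : T -> set A)
    (N : set A) : Prop :=
  N = addspan (\bigcup_t (N `&` C t)).

Section SpanTheory.
Variable A : zmodType.
Implicit Types (S X P : set A).

Lemma subgroupN S x : subgroup S -> S x -> S (- x).
Proof. by move=> [S0 SB] Sx; rewrite -sub0r; exact: SB. Qed.

Lemma subgroupD S x y : subgroup S -> S x -> S y -> S (x + y).
Proof.
by move=> sS Sx Sy; rewrite -[y]opprK; apply: sS.2 => //; exact: subgroupN.
Qed.

Lemma subgroup_sum S (T : Type) (r : seq T) (F : T -> A) :
  subgroup S -> (forall t, S (F t)) -> S (\sum_(t <- r) F t).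
Proof. by move=> sS SF; elim/big_ind: _ => // [|*]; [exact: sS.1|exact: subgroupD]. Qed.

Lemma addspan_subgroup X : subgroup (addspan X).
Proof.
split=> [S [[S0 _] _] //|x y Sx Sy S SX].
by apply: SX.1.2; [exact: Sx | exact: Sy].
Qed.

Lemma addspan_sub X : X `<=` addspan X.
Proof. exact: sub_gen_smallest. Qed.

Lemma addspan_ind X P : subgroup P -> X `<=` P -> addspan X `<=` P.
Proof. exact: smallest_sub. Qed.

Lemma morphB0 (B : zmodType) (f : A -> B) : {morph f : x y / x - y} -> f 0 = 0.
Proof. by move=> fB; rewrite -(subrr 0) fB subrr. Qed.

Lemma morphB_sum (B : zmodType) (f : A -> B) (T : Type) (r : seq T)
    (F : T -> A) : {morph f : x y / x - y} ->
  f (\sum_(t <- r) F t) = \sum_(t <- r) f (F t).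
Proof.
move=> fB; have f0 := morphB0 fB.
have fN y : f (- y) = - f y by rewrite -sub0r fB f0 sub0r.
apply: (big_morph f) => // x y.
by rewrite -[y in LHS]opprK fB fN opprK.
Qed.

Lemma subgroup_equalizer (B : zmodType) (f g : A -> B) :
  {morph f : x y / x - y} -> {morph g : x y / x - y} ->
  subgroup [set x | f x = g x].
Proof.
move=> fB gB; split=> /= [|x y fx fy]; last by rewrite fB gB fx fy.
by rewrite (morphB0 fB) (morphB0 gB).
Qed.

End SpanTheory.

Lemma finite_set_seq (T : Type) (S : set T) : finite_set S ->
  exists s : seq {classic T}, uniq s /\ forall t, S t -> t \in s.
Proof.
move=> /(@finite_seqP {classic T})[s Ss]; exists (undup s).
split=> [|t]; first exact: undup_uniq.
by rewrite Ss /= => ts; rewrite (@mem_undup {classic T}).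
Qed.

Section SumTheory.
Variables (T : Type) (A : zmodType).
Implicit Types (a b : T -> A) (C : T -> set A).

Lemma fsumE a (s : seq {classic T}) :
  uniq s -> (forall t, a t <> 0 -> t \in s) -> fsum a = \sum_(t <- s) a t.
Proof.
move=> us as_; rewrite /fsum (@fsbig_seq A 0 +%R {classic T} s)//; apply/esym.
apply: (@fsbig_widen {classic T} A 0 +%R) => // t [_ /= ts].
by apply: contrapT => /as_.
Qed.

Lemma finite_support0 : finite_support (fun _ : T => 0 : A).
Proof. by apply: (sub_finite_set _ (finite_set0 T)) => t. Qed.

Lemma finite_supportB a b : finite_support a -> finite_support b ->
  finite_support (fun t => a t - b t).
Proof.
move=> fa fb; have : finite_set ([set t | a t <> 0] `|` [set t | b t <> 0]).
  by rewrite finite_setU.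
apply: sub_finite_set => t /= abt; apply: contrapT => /not_orP[].
by move=> /contrapT a0 /contrapT b0; apply: abt; rewrite a0 b0 subr0.
Qed.

Lemma fsumB a b : finite_support a -> finite_support b ->
  fsum (fun t => a t - b t) = fsum a - fsum b.
Proof.
move=> fa fb; have : finite_set ([set t | a t <> 0] `|` [set t | b t <> 0]).
  by rewrite finite_setU.
move=> /finite_set_seq[s [us sab]].
rewrite (@fsumE a s)//; last by move=> t at0; apply: sab; left.
rewrite (@fsumE b s)//; last by move=> t at0; apply: sab; right.
rewrite (@fsumE _ s) ?sumrB// => t /= abt; apply: sab; apply: contrapT.
by move=> /not_orP[/contrapT a0 /contrapT b0]; apply: abt; rewrite a0 b0 subr0.
Qed.

Lemma fsum1 a t0 : (forall t, t <> t0 -> a t = 0) -> fsum a = a t0.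
Proof.
move=> a0; rewrite (@fsumE _ [:: t0]) ?big_seq1// => t at0.
rewrite (@mem_seq1 {classic T}); apply/(@eqP {classic T}).
by apply: contrapT => /a0.
Qed.

Lemma subgroup_fsum (S : set A) a :
  subgroup S -> (forall t, S (a t)) -> S (fsum a).
Proof. by move=> sS Sa; exact: subgroup_sum. Qed.

Lemma direct_decomp C (dC : direct_sum C) (x : A) :
  exists a : T -> A, [/\ finite_support a, forall t, C t (a t) & x = fsum a].
Proof.
case: dC => sC _ spanC.
have : addspan (\bigcup_t C t) x by rewrite spanC.
move: x; apply: addspan_ind => [|x [t _ Ctx]].
  split=> [|_ _ [a [fa Ca ->]] [b [fb Cb ->]]].
    exists (fun=> 0); split=> [|t|]; [exact: finite_support0|exact: (sC t).1|].
    by rewrite (@fsumE _ [::]) ?big_nil// => t /(_ erefl).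
  exists (fun t => a t - b t); split=> [|t|]; first exact: finite_supportB.
    exact: (sC t).2.
  by rewrite fsumB.
exists (fun t' => if pselect (t' = t) then x else 0); split=> [|t'|].
- apply: (sub_finite_set _ (finite_set1 t)) => t' /=.
  by case: pselect => //= ? /(_ erefl).
- by case: pselect => e /=; [rewrite e|exact: (sC t').1].
- by rewrite (@fsum1 _ t) => [|t']; case: pselect.
Qed.

Definition hcomp C (dC : direct_sum C) (x : A) : T -> A :=
  projT1 (cid (direct_decomp dC x)).

(* the projection of [A] onto the sum of the [C t] with [P t], along the sum
   of the others *)
Definition hpart C (dC : direct_sum C) (P : set T) (x : A) : A :=
  fsum (fun t => if pselect (P t) then hcomp dC x t else 0).

Section Direct.
Variables (C : T -> set A) (dC : direct_sum C).

Lemma finite_support_if (P : set T) a : finite_support a ->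
  finite_support (fun t => if pselect (P t) then a t else 0).
Proof. by apply: sub_finite_set => t /=; case: pselect. Qed.

Lemma hcompP x : [/\ finite_support (hcomp dC x),
  forall t, C t (hcomp dC x t) & x = fsum (hcomp dC x)].
Proof. by rewrite /hcomp; case: cid. Qed.

Lemma hcomp_uniq x a : finite_support a -> (forall t, C t (a t)) ->
  x = fsum a -> hcomp dC x = a.
Proof.
move=> fa Ca xa; case: (hcompP x) => fx Cx xx; have [sC iC _] := dC.
apply/funext => t; apply/subr0_eq.
apply: (iC (fun t => hcomp dC x t - a t)); first exact: finite_supportB.
  by move=> t'; exact: (sC t').2.
by rewrite fsumB// -xx -xa subrr.
Qed.

Lemma hcompB x y t : hcomp dC (x - y) t = hcomp dC x t - hcomp dC y t.
Proof.
have [fx Cx xx] := hcompP x; have [fy Cy yy] := hcompP y.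
rewrite (@hcomp_uniq _ (fun t => hcomp dC x t - hcomp dC y t))//.
- exact: finite_supportB.
- by have [sC _ _] := dC; move=> t'; exact: (sC t').2.
- by rewrite fsumB// -xx -yy.
Qed.

Lemma hpartB P : {morph hpart dC P : x y / x - y}.
Proof.
move=> x y; rewrite /hpart.
have fin z : finite_support (fun t => if pselect (P t) then hcomp dC z t else 0).
  by have [fz _ _] := hcompP z; exact: finite_support_if.
rewrite -fsumB//.
congr fsum; apply/funext => t; case: pselect => Pt /=; last by rewrite subr0.
exact: hcompB.
Qed.

Lemma hcompE t x : C t x ->
  hcomp dC x = fun t' => if pselect (t' = t) then x else 0.
Proof.
move=> Ctx; have [sC _ _] := dC; apply: hcomp_uniq => [|t'|].
- apply: (sub_finite_set _ (finite_set1 t)) => t' /=.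
  by case: pselect => //= ? /(_ erefl).
- by case: pselect => e /=; [rewrite e|exact: (sC t').1].
- by rewrite (@fsum1 _ t) => [|t']; case: pselect.
Qed.

Lemma hpart_id (P : set T) t x : P t -> C t x -> hpart dC P x = x.
Proof.
move=> Pt Ctx; rewrite /hpart (hcompE Ctx) (@fsum1 _ t).
  by do 2 case: pselect => //=.
by move=> t' tt'; do 2 case: pselect => //=.
Qed.

Lemma hpart_0 (P : set T) t x : ~ P t -> C t x -> hpart dC P x = 0.
Proof.
move=> Pt Ctx; rewrite /hpart (hcompE Ctx) (@fsum1 _ t).
  by do 2 case: pselect => //=.
by move=> t' tt'; do 2 case: pselect => //=.
Qed.

Lemma direct_ind (B : zmodType) (f g : A -> B) :
  {morph f : x y / x - y} -> {morph g : x y / x - y} ->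
  (forall t x, C t x -> f x = g x) -> f = g.
Proof.
move=> fB gB fg; apply/funext => x.
have : addspan (\bigcup_t C t) x by case: dC => _ _ ->.
move: x; apply: addspan_ind; first exact: subgroup_equalizer.
by move=> x [t _ Ctx]; exact: fg Ctx.
Qed.

End Direct.
End SumTheory.

Record grRing (G : groupoid) := GrRing {
  gr_sort :> zmodType;
  gmul : gr_sort -> gr_sort -> gr_sort;
  rcomp : G -> set gr_sort;
  gone : obj G -> gr_sort;
  gmulA : associative gmul;
  gmulDl : left_distributive gmul +%R;
  gmulDr : right_distributive gmul +%R;
  rcomp_direct : direct_sum rcomp;
  rcompM : forall g h a b, src g = tgt h ->
    rcomp g a -> rcomp h b -> rcomp (gcomp g h) (gmul a b);
  rcompM0 : forall g h a b, src g <> tgt h ->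
    rcomp g a -> rcomp h b -> gmul a b = 0;
  gone_comp : forall e, rcomp (idn e) (gone e);
  gone_mul : forall g a, rcomp g a -> gmul (gone (tgt g)) a = a;
  gmul_one : forall g a, rcomp g a -> gmul a (gone (src g)) = a }.

Arguments gmul {_ _} _ _.
Arguments rcomp {_} _ _ _.
Arguments gone {_} _ _.

Record grMod (G : groupoid) (R : grRing G) := GrMod {
  gm_sort :> zmodType;
  gact : gm_sort -> R -> gm_sort;
  mcomp : G -> set gm_sort;
  gactA : forall v a b, gact (gact v a) b = gact v (gmul a b);
  gactDl : forall v w a, gact (v + w) a = gact v a + gact w a;
  gactDr : forall v a b, gact v (a + b) = gact v a + gact v b;
  mcomp_direct : direct_sum mcomp;
  mcompM : forall g h v a, src g = tgt h ->
    mcomp g v -> rcomp R h a -> mcomp (gcomp g h) (gact v a);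
  mcompM0 : forall g h v a, src g <> tgt h ->
    mcomp g v -> rcomp R h a -> gact v a = 0;
  gact_full : addspan [set gact v a | v in setT & a in setT] = setT }.

Arguments gact {_ _ _} _ _.
Arguments mcomp {_ _} _ _ _.

Section GrTheory.
Variables (G : groupoid) (R : grRing G).
Implicit Types (x y z : R).

Lemma gmulBl z : {morph (fun x => gmul x z) : x y / x - y}.
Proof.
move=> x y /=; have := gmulDl (x - y) y z; rewrite subrK => ->.
by rewrite addrK.
Qed.

Lemma gmulBr z : {morph gmul z : x y / x - y}.
Proof.
move=> x y /=; have := gmulDr z (x - y) y; rewrite subrK => ->.
by rewrite addrK.
Qed.

Lemma gmul0l x : gmul 0 x = 0.
Proof. exact: morphB0 (gmulBl x). Qed.

Lemma gmul0r x : gmul x 0 = 0.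
Proof. exact: morphB0 (gmulBr x). Qed.

End GrTheory.

Lemma gactBl (G : groupoid) (R : grRing G) (M : grMod R) (a : R) :
  {morph (fun v : M => gact v a) : x y / x - y}.
Proof.
move=> x y /=; have := gactDl (x - y) y a; rewrite subrK => ->.
by rewrite addrK.
Qed.

Lemma gactBr (G : groupoid) (R : grRing G) (M : grMod R) (v : M) :
  {morph @gact _ _ M v : x y / x - y}.
Proof.
move=> x y /=; have := gactDr v (x - y) y; rewrite subrK => ->.
by rewrite addrK.
Qed.

Section Regular.
Variables (G : groupoid) (R : grRing G).

Fact regular_full : addspan [set gmul v a | v in [set: R] & a in [set: R]] = setT.
Proof.
apply/seteqP; split=> // x _; have [_ _ spanR] := rcomp_direct R.
have : addspan (\bigcup_g rcomp R g) x by rewrite spanR.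
move: x; apply: addspan_ind; first exact: addspan_subgroup.
move=> x [g _ Cx]; apply: addspan_sub; exists x => //.
by exists (gone R (src g)) => //; exact: gmul_one Cx.
Qed.

Definition regular : grMod R :=
  @GrMod G R R gmul (rcomp R) (fun x y z => esym (gmulA x y z))
    (@gmulDl _ R) (@gmulDr _ R) (rcomp_direct R)
    (@rcompM _ R) (@rcompM0 _ R) regular_full.

End Regular.

Section Notions.
Variable G : groupoid.
Implicit Types (R S D : grRing G) (e f : obj G).

Definition gr_iso R S : Prop :=
  exists f : R -> S,
    [/\ bijective f,
        forall x y, f (x + y) = f x + f y,
        forall x y, f (gmul x y) = gmul (f x) (f y) &
        forall g x, rcomp R g x -> rcomp S g (f x)].

Definition gr_ideal R (J : set R) : Prop :=
  [/\ subgroup J,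
      forall a x, J x -> J (gmul a x),
      forall x a, J x -> J (gmul x a) &
      graded_set (rcomp R) J].

Definition ideal_prod R (I J : set R) : set R :=
  addspan [set gmul x y | x in I & y in J].

Definition gr_simple R : Prop :=
  (exists x : R, x <> 0) /\
  forall J : set R, gr_ideal J -> J = [set 0] \/ J = setT.

Definition gr_prime R : Prop :=
  forall I J : set R, gr_ideal I -> gr_ideal J ->
    I <> [set 0] -> J <> [set 0] -> ideal_prod I J <> [set 0].

Definition gr_division D : Prop :=
  (exists x : D, x <> 0) /\
  forall g a, rcomp D g a -> a <> 0 ->
    exists b, [/\ rcomp D (ginv g) b,
                  gmul a b = gone D (tgt g) &
                  gmul b a = gone D (src g)].

Definition supp R : set G := [set g | rcomp R g <> [set 0]].

Definition obj' R : set (obj G) := [set e | gone R e <> 0].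

(* eΓf: the morphisms from f to e *)
Definition corner e f : set G := [set g | tgt g = e /\ src g = f].

Definition submodule R (M : grMod R) (N : set M) : Prop :=
  subgroup N /\ forall v a, N v -> N (gact v a).

Definition graded_submodule R (M : grMod R) (N : set M) : Prop :=
  submodule N /\ graded_set (mcomp M) N.

(* M(e) *)
Definition fiber R (M : grMod R) e : set M :=
  addspan (\bigcup_(g in [set g | tgt g = e]) mcomp M g).
Arguments fiber {R} M e _.

Definition dcc R (M : grMod R) (P : set M) : Prop :=
  forall N : nat -> set M,
    (forall n, graded_submodule (N n) /\ N n `<=` P) ->
    (forall n, N n.+1 `<=` N n) ->
    exists n, forall k, (n <= k)%N -> N k = N n.

(* Γ_0-artinian: [fiber (regular R) e] is 1_e R by [fiber_regular]. *)
Definition obj_artinian R : Prop := forall e, dcc (fiber (regular R) e).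

Lemma fiber_regular R e : fiber (regular R) e = range (gmul (gone R e)).
Proof.
apply/seteqP; split.
  apply: addspan_ind => [|x [g /= <- Cx]]; last by exists x => //; exact: gone_mul Cx.
  split=> [|_ _ [x _ <-] [y _ <-]]; first by exists 0 => //; exact: gmul0r.
  by exists (x - y) => //; exact: gmulBr.
move=> _ [x _ <-]; have [RC _ spanR] := rcomp_direct R.
have : addspan (\bigcup_g rcomp R g) x by rewrite spanR.
have sF : subgroup (fiber (regular R) e) by exact: addspan_subgroup.
apply: (@addspan_ind _ _ [set x | fiber (regular R) e (gmul (gone R e) x)]).
  split=> [|y z Fy Fz] /=; first by rewrite gmul0r; exact: sF.1.
  by rewrite gmulBr; exact: sF.2.
move=> y [g _ Cy] /=; have [ge|ge] := pselect (tgt g = e).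
  by rewrite -ge (gone_mul Cy); apply: addspan_sub; exists g.
rewrite (rcompM0 _ (gone_comp R e) Cy); first exact: sF.1.
by rewrite src_idn => eg; apply: ge.
Qed.

(* [x], with degrees [g], is a pseudo-basis of the graded submodule [N]. *)
Definition pseudo_basis R (M : grMod R) (N : set M) (I : Type)
    (x : I -> M) (g : I -> G) : Prop :=
  [/\ forall i, x i <> 0 /\ mcomp M (g i) (x i),
      N = smallest (@submodule R M) (range x) &
      forall a : I -> R, finite_support a ->
        (forall i, range (gmul (gone R (src (g i)))) (a i)) ->
        fsum (fun i => gact (x i) (a i)) = 0 -> forall i, a i = 0].

Definition has_pseudo_dim R (M : grMod R) (N : set M) (n : nat) : Prop :=
  exists (x : 'I_n -> M) (g : 'I_n -> G), pseudo_basis N x g.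

Definition obj_finite_dim D (V : grMod D) : Prop :=
  forall e, exists n, has_pseudo_dim (fiber V e) n.

End Notions.

Section SpanType.
Variables (A : zmodType) (X : set A).

Definition span_pred : {pred A} := fun x => `[< addspan X x >].

Lemma span_predP x : reflect (addspan X x) (x \in span_pred).
Proof. exact: asboolP. Qed.

Fact span_zmod_closed : GRing.zmod_closed span_pred.
Proof.
have [S0 SB] := addspan_subgroup X.
split=> [|x y]; first exact/span_predP.
by move=> /span_predP Sx /span_predP Sy; apply/span_predP; exact: SB.
Qed.

HB.instance Definition _ := GRing.isZmodClosed.Build A span_pred span_zmod_closed.

Record spanT := SpanT { spanval :> A; _ : spanval \in span_pred }.

HB.instance Definition _ := [isSub for spanval].
HB.instance Definition _ := [Choice of spanT by <:].
HB.instance Definition _ := [SubChoice_isSubZmodule of spanT by <:].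

End SpanType.

Section GrSpan.
Variables (G : groupoid) (A : zmodType) (C : G -> set A).
Variables (m : A -> A -> A) (u : obj G -> A).
Let S := addspan (\bigcup_g C g).

Record gr_laws : Prop := GrLaws {
  axC : forall g, subgroup (C g);
  axI : independent C;
  axA : forall x y z, S x -> S y -> S z -> m x (m y z) = m (m x y) z;
  axDl : forall x y z, S x -> S y -> S z -> m (x + y) z = m x z + m y z;
  axDr : forall x y z, S x -> S y -> S z -> m x (y + z) = m x y + m x z;
  axM : forall g h a b, src g = tgt h ->
    C g a -> C h b -> C (gcomp g h) (m a b);
  axM0 : forall g h a b, src g <> tgt h -> C g a -> C h b -> m a b = 0;
  axu : forall e, C (idn e) (u e);
  axul : forall g a, C g a -> m (u (tgt g)) a = a;
  axur : forall g a, C g a -> m a (u (src g)) = a }.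

Hypothesis ax : gr_laws.
Let sS : subgroup S. Proof. exact: addspan_subgroup. Qed.

Let CS g x : C g x -> S x.
Proof. by move=> Cx; apply: addspan_sub; exists g. Qed.

Let mBl x y z : S x -> S y -> S z -> m (x - y) z = m x z - m y z.
Proof.
move=> Sx Sy Sz; have := axDl ax (sS.2 _ _ Sx Sy) Sy Sz.
by rewrite subrK => ->; rewrite addrK.
Qed.

Let mBr x y z : S x -> S y -> S z -> m x (y - z) = m x y - m x z.
Proof.
move=> Sx Sy Sz; have := axDr ax Sx (sS.2 _ _ Sy Sz) Sz.
by rewrite subrK => ->; rewrite addrK.
Qed.

Fact gr_span_mul x y : S x -> S y -> S (m x y).
Proof.
have key (P : A -> A) z : S z -> (forall x y, S x -> S y -> P (x - y) = P x - P y) ->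
    (forall g x, C g x -> S (P x)) -> S (P z).
  move=> Sz PB CP; suff: S `<=` (fun z => S z /\ S (P z)) by move=> /(_ z Sz)[].
  apply: addspan_ind => [|w [g _ Cw]]; last by split; [exact: CS Cw|exact: CP Cw].
  split=> [|w1 w2 [S1 P1] [S2 P2]].
    by split; [exact: sS.1|rewrite -(subrr 0) PB ?subrr; exact: sS.1].
  by split; [exact: sS.2|rewrite PB//; exact: sS.2].
move=> Sx Sy; apply: (key (fun z => m z y)) => // [*|g a Ca]; first exact: mBl.
apply: (key (m a)) => // [*|h b Cb]; first by apply: mBr => //; exact: CS Ca.
have [gh|gh] := pselect (src g = tgt h); first by apply: CS (axM ax gh Ca Cb).
by rewrite (axM0 ax gh Ca Cb); exact: sS.1.
Qed.

Let T := spanT (\bigcup_g C g).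
Let TS (x : T) : S x.
Proof. exact/span_predP/(valP x). Qed.

Definition span_mul (x y : T) : T :=
  SpanT (introT (span_predP _ _) (gr_span_mul (TS x) (TS y))).

Definition span_comp (g : G) : set T := [set x | C g (val x)].

Definition span_one (e : obj G) : T :=
  SpanT (introT (span_predP _ _) (CS (axu ax e))).

Fact span_mulA : associative span_mul.
Proof. by move=> x y z; apply: val_inj; apply: (axA ax); exact: TS. Qed.

Fact span_mulDl : left_distributive span_mul +%R.
Proof. by move=> x y z; apply: val_inj; apply: (axDl ax); exact: TS. Qed.

Fact span_mulDr : right_distributive span_mul +%R.
Proof. by move=> x y z; apply: val_inj; apply: (axDr ax); exact: TS. Qed.

Fact span_comp_direct : direct_sum span_comp.
Proof.
split=> [g|a fa Ca a0 g|].
- split=> [|x y Cx Cy]; rewrite /span_comp /=; first exact: (axC ax g).1.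
  exact: (axC ax g).2.
- apply: val_inj; apply: (axI ax (a := fun g => val (a g))) => //.
    by apply: sub_finite_set fa => g' /= ag' /eqP; apply/negP/eqP => e; rewrite e in ag'.
  have [s [us sa]] := finite_set_seq fa.
  rewrite (@fsumE _ _ _ s)//; last by move=> t at0; apply: sa => /= e; rewrite e in at0.
  by rewrite -raddf_sum -(@fsumE _ _ a s)// a0.
- apply/seteqP; split=> // x _.
  suff: S `<=` [set y | exists2 z : T, val z = y & addspan (\bigcup_g span_comp g) z].
    by move=> /(_ _ (TS x))[z /val_inj ->].
  apply: addspan_ind => [|y [g _ Cy]]; last first.
    exists (SpanT (introT (span_predP _ _) (CS Cy))) => //.
    by apply: addspan_sub; exists g.
  split=> [|_ _ [z1 <- h1] [z2 <- h2]].
    by exists 0 => //; exact: (addspan_subgroup _).1.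
  by exists (z1 - z2) => //; exact: (addspan_subgroup _).2.
Qed.

Fact span_mul_deg g h a b : src g = tgt h -> span_comp g a -> span_comp h b ->
  span_comp (gcomp g h) (span_mul a b).
Proof. exact: axM. Qed.

Fact span_mul_deg0 g h a b : src g <> tgt h -> span_comp g a ->
  span_comp h b -> span_mul a b = 0.
Proof. by move=> gh Ca Cb; apply: val_inj; exact: (axM0 ax gh). Qed.

Fact span_one_comp e : span_comp (idn e) (span_one e).
Proof. exact: axu. Qed.

Fact span_one_mul g a : span_comp g a -> span_mul (span_one (tgt g)) a = a.
Proof. by move=> Ca; apply: val_inj; exact: (axul ax). Qed.

Fact span_mul_one g a : span_comp g a -> span_mul a (span_one (src g)) = a.
Proof. by move=> Ca; apply: val_inj; exact: (axur ax). Qed.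

(* The internal direct sum of the subgroups [C g], with product [m]. *)
Definition gr_span : grRing G := GrRing span_mulA span_mulDl span_mulDr
  span_comp_direct span_mul_deg span_mul_deg0 span_one_comp span_one_mul
  span_mul_one.

End GrSpan.

Section Matrix.
Variables (G : groupoid) (D : grRing G) (I : Type).
Implicit Types (Sg : I -> set G) (f g h : I -> I -> D).

Definition matricial Sg : Prop :=
  [/\ forall i, Sg i !=set0,
      forall i s t, Sg i s -> Sg i t -> src s = src t -> s = t,
      forall i s t, Sg i s -> Sg i t -> tgt s = tgt t -> s = t,
      forall i s, Sg i s -> obj' D (tgt s) &
      forall e : obj G, finite_set [set i | exists2 s, Sg i s & src s = e]].

Definition d_finite (sg : I -> G) : Prop :=
  forall e : obj G, finite_set [set i | src (sg i) = e].

(* the subgroup D_{Σ_i γ Σ_j^-1}, for A = Σ_i and B = Σ_j *)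
Definition twisted (A : set G) (c : G) (B : set G) : set D :=
  [set x | x = 0 \/ exists s t, [/\ A s, B t, src s = tgt c, src t = src c &
                                   rcomp D (gcomp (gcomp s c) (ginv t)) x]].

Definition finite_mx : set (I -> I -> D) :=
  [set f | finite_set [set p : I * I | f p.1 p.2 <> 0]].

Definition mx_comp Sg (c : G) : set (I -> I -> D) :=
  [set f | finite_mx f /\ forall i j, twisted (Sg i) c (Sg j) (f i j)].

Definition mx_mul f g : I -> I -> D :=
  fun i k => fsum (fun j => gmul (f i j) (g j k)).

(* the diagonal matrix with entry 1_{r(σ)} at (i, i) if some σ ∈ Σ_i has
   d(σ) = e *)
Definition mx_one Sg (e : obj G) : I -> I -> D := fun i j =>
  if pselect (i = j /\ exists s, Sg i s /\ src s = e) is left h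
  then gone D (tgt (projT1 (cid h.2))) else 0.

Section Laws.
Variables (Sg : I -> set G) (mSg : matricial Sg).

Let usrc i s t : Sg i s -> Sg i t -> src s = src t -> s = t.
Proof. by case: mSg => _ + _ _ _; apply. Qed.

Let utgt i s t : Sg i s -> Sg i t -> tgt s = tgt t -> s = t.
Proof. by case: mSg => _ _ + _ _; apply. Qed.

Lemma twisted_eq i c j s t : Sg i s -> Sg j t -> src s = tgt c ->
  src t = src c ->
  twisted (Sg i) c (Sg j) = rcomp D (gcomp (gcomp s c) (ginv t)).
Proof.
move=> Ss St sc tc; have [sC _ _] := rcomp_direct D.
apply/seteqP; split=> x; last by move=> Cx; right; exists s, t.
case=> [->|]; first exact: (sC _).1.
move=> [s' [t' [Ss' St' sc' tc']]].
by rewrite (usrc Ss' Ss) ?sc ?sc'// (usrc St' St) ?tc ?tc'.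
Qed.

Lemma twisted_eq0 i c j :
  ~ (exists s t, [/\ Sg i s, Sg j t, src s = tgt c & src t = src c]) ->
  twisted (Sg i) c (Sg j) = [set 0].
Proof.
move=> n; apply/seteqP; split=> x; last by left.
by case=> // -[s [t [Ss St sc tc _]]]; case: n; exists s, t.
Qed.

Lemma twisted_subgroup i c j : subgroup (twisted (Sg i) c (Sg j)).
Proof.
have [[s [t [Ss St sc tc]]]|n] :=
  pselect (exists s t, [/\ Sg i s, Sg j t, src s = tgt c & src t = src c]).
  by rewrite (twisted_eq Ss St)//; have [sC _ _] := rcomp_direct D; exact: sC.
by rewrite twisted_eq0//; split=> // x y -> ->; rewrite /= subr0.
Qed.

Lemma finite_mx_subgroup : subgroup finite_mx.
Proof.
split=> [|f g ff fg].
  by apply: (sub_finite_set _ (finite_set0 (I * I)%type)) => p.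
rewrite /finite_mx /=; have : finite_set
    ([set p : I * I | f p.1 p.2 <> 0] `|` [set p | g p.1 p.2 <> 0]).
  by rewrite finite_setU.
apply: sub_finite_set => p /= fgp; apply: contrapT.
by move=> /not_orP[/contrapT a0 /contrapT b0]; apply: fgp; rewrite !fctE a0 b0 subr0.
Qed.

Lemma finite_mx_seq f : finite_mx f -> exists s : seq {classic I},
  uniq s /\ forall i j, f i j <> 0 -> i \in s /\ j \in s.
Proof.
move=> ff.
have [|s [us fs]] := @finite_set_seq I
    ((fst @` [set p : I * I | f p.1 p.2 <> 0]) `|`
     (snd @` [set p : I * I | f p.1 p.2 <> 0])).
  by rewrite finite_setU; split; exact: finite_image.
by exists s; split=> // i j fij; split; apply: fs; [left|right]; exists (i, j).
Qed.

Lemma mx_comp_subgroup c : subgroup (mx_comp Sg c).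
Proof.
split=> [|f g [ff Tf] [fg Tg]].
  split; first exact: finite_mx_subgroup.1.
  by move=> i j; exact: (twisted_subgroup i c j).1.
split; first exact: finite_mx_subgroup.2.
by move=> i j; exact: (twisted_subgroup i c j).2.
Qed.

Lemma mx_span_finite : addspan (\bigcup_c mx_comp Sg c) `<=` finite_mx.
Proof.
by apply: addspan_ind; [exact: finite_mx_subgroup|move=> f [c _ []]].
Qed.

Lemma gcomp_cancel (s t c c' : G) : src s = tgt c -> src t = src c ->
  src s = tgt c' -> src t = src c' ->
  gcomp (gcomp s c) (ginv t) = gcomp (gcomp s c') (ginv t) -> c = c'.
Proof.
have key d : src s = tgt d -> src t = src d ->
    gcomp (gcomp (ginv s) (gcomp (gcomp s d) (ginv t))) t = d.
  move=> sd td.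
  have e1 : src (gcomp s d) = tgt (ginv t) by rewrite src_comp// tgt_inv.
  rewrite gcompA ?src_inv ?tgt_comp//.
  rewrite (@gcompA _ (ginv s))// ?src_inv// gcompVg sd gcomp_idl.
  rewrite -gcompA ?src_inv ?tgt_inv//.
  by rewrite gcompVg td gcomp_idr.
by move=> sc tc sc' tc' e; rewrite -(key c)// e key.
Qed.

Lemma mx_comp_independent : independent (mx_comp Sg).
Proof.
move=> a fa Ca a0 c; apply/funext => i; apply/funext => j; apply: contrapT => nz.
have [s [us sa]] := finite_set_seq fa.
have cs : (c : {classic G}) \in s.
  by apply: sa => /= e; apply: nz; rewrite e.
have [_ /(_ i j)[//|[sg [tu [Ss St sc tc Cx]]]]] := Ca c.
pose P := [set gcomp (gcomp sg c) (ginv tu)].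
have : hpart (rcomp_direct D) P (fsum a i j) = 0.
  by rewrite a0 (morphB0 (hpartB (rcomp_direct D) P)).
have -> : fsum a i j = \sum_(d <- s) a d i j.
  by rewrite (@fsumE _ _ a s)// !fct_sumE.
rewrite (morphB_sum _ _ (hpartB (rcomp_direct D) P)).
rewrite (@bigD1_seq _ _ _ {classic G} s c)//= (hpart_id _ _ Cx)//.
rewrite big1 ?addr0// => d /eqP dc.
have [_ /(_ i j)[->|[s' [t' [Ss' St' sd td Cd]]]]] := Ca d.
  exact: (morphB0 (hpartB _ P)).
apply: hpart_0 Cd; rewrite /P /= => e; apply: dc.
have es : s' = sg.
  apply: utgt Ss' Ss _; have := congr1 tgt e.
  by rewrite !tgt_comp// ?src_comp// tgt_inv.
have et : t' = tu.
  apply: utgt St' St _; have := congr1 src e.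
  by rewrite !src_comp// ?src_comp ?tgt_inv// !src_inv.
by move: sd td e; rewrite es et => sd td; exact: gcomp_cancel.
Qed.

Lemma mx_mulE (s : seq {classic I}) f g i k : uniq s ->
  (forall j, gmul (f i j) (g j k) <> 0 -> j \in s) ->
  mx_mul f g i k = \sum_(j <- s) gmul (f i j) (g j k).
Proof. exact: fsumE. Qed.

Lemma mx_mulDl f g h : finite_mx h ->
  mx_mul (f + g) h = mx_mul f h + mx_mul g h.
Proof.
move=> fh; have [s [us hs]] := finite_mx_seq fh.
apply/funext => i; apply/funext => k.
have E (p : I -> I -> D) : mx_mul p h i k = \sum_(j <- s) gmul (p i j) (h j k).
  by apply: mx_mulE => // j; apply: contra_notP => js;
     have [->|/hs[]//] := pselect (h j k = 0); rewrite gmul0r.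
rewrite (_ : (mx_mul f h + mx_mul g h) i k = mx_mul f h i k + mx_mul g h i k)//.
rewrite !E -big_split; apply: eq_bigr => j _.
exact: gmulDl.
Qed.

Lemma mx_mulDr f g h : finite_mx f ->
  mx_mul f (g + h) = mx_mul f g + mx_mul f h.
Proof.
move=> ff; have [s [us fs]] := finite_mx_seq ff.
apply/funext => i; apply/funext => k.
have E (p : I -> I -> D) : mx_mul f p i k = \sum_(j <- s) gmul (f i j) (p j k).
  by apply: mx_mulE => // j; apply: contra_notP => js;
     have [->|/fs[]//] := pselect (f i j = 0); rewrite gmul0l.
rewrite (_ : (mx_mul f g + mx_mul f h) i k = mx_mul f g i k + mx_mul f h i k)//.
rewrite !E -big_split; apply: eq_bigr => j _.
exact: gmulDr.
Qed.

Lemma mx_mulA f g h : finite_mx f -> finite_mx g -> finite_mx h ->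
  mx_mul f (mx_mul g h) = mx_mul (mx_mul f g) h.
Proof.
move=> ff fg fh; have [s [us gs]] := finite_mx_seq fg.
apply/funext => i; apply/funext => l.
have E1 j : mx_mul g h j l = \sum_(k <- s) gmul (g j k) (h k l).
  by apply: mx_mulE => // k; apply: contra_notP => js;
     have [->|/gs[]//] := pselect (g j k = 0); rewrite gmul0l.
have E2 k : mx_mul f g i k = \sum_(j <- s) gmul (f i j) (g j k).
  by apply: mx_mulE => // j; apply: contra_notP => js;
     have [->|/gs[]//] := pselect (g j k = 0); rewrite gmul0r.
rewrite (mx_mulE (s := s))//; last first.
  move=> j; apply: contra_notP => js; rewrite E1 big1 ?gmul0r// => k _.
  by have [->|/gs[]//] := pselect (g j k = 0); rewrite gmul0l.
rewrite [RHS](mx_mulE (s := s))//; last first.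
  move=> k; apply: contra_notP => js; rewrite E2 big1 ?gmul0l// => j _.
  by have [->|/gs[]//] := pselect (g j k = 0); rewrite gmul0r.
under eq_bigr do rewrite E1 (morphB_sum _ _ (gmulBr _)).
rewrite exchange_big; apply: eq_bigr => k _; rewrite E2.
rewrite (morphB_sum _ _ (@gmulBl _ _ (h k l))); apply: eq_bigr => j _.
exact: gmulA.
Qed.

Lemma finite_mx_mul f g : finite_mx f -> finite_mx g -> finite_mx (mx_mul f g).
Proof.
move=> /finite_mx_seq[s [us fs]] /finite_mx_seq[t [ut gt]].
have /sub_finite_set : [set p : I * I | mx_mul f g p.1 p.2 <> 0] `<=`
    [set i : I | (i : {classic I}) \in s] `*` [set i : I | (i : {classic I}) \in t].
  move=> [i k] /= fgik; have [j] : exists j, gmul (f i j) (g j k) <> 0.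
    apply: contrapT => /forallNP n; apply: fgik.
    by rewrite (mx_mulE (s := [::])) ?big_nil// => j /n.
  move=> fgj; split=> /=.
    by have [f0|/fs[]//] := pselect (f i j = 0); case: fgj; rewrite f0 gmul0l.
  by have [g0|/gt[]//] := pselect (g j k = 0); case: fgj; rewrite g0 gmul0r.
by apply; apply: finite_setX; exact: (@finite_seq {classic I}).
Qed.

Lemma mx_comp_mul c d f g : src c = tgt d -> mx_comp Sg c f -> mx_comp Sg d g ->
  mx_comp Sg (gcomp c d) (mx_mul f g).
Proof.
move=> cd [ff Cf] [fg Cg]; split; first exact: finite_mx_mul.
move=> i k; apply: subgroup_fsum => [|j]; first exact: twisted_subgroup.
have [->|[s [t [Ss St sc tc Cx]]]] := Cf i j.
  by rewrite gmul0l; left.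
have [->|[t' [v [St' Sv td vd Cy]]]] := Cg j k.
  by rewrite gmul0r; left.
have tt' : t' = t by apply: usrc St' St _; rewrite td -cd.
subst t'; right; exists s, v; split=> //; first by rewrite tgt_comp.
  by rewrite src_comp.
have e1 : src (gcomp s c) = tgt (ginv t) by rewrite src_comp// tgt_inv.
have e2 : src (gcomp t d) = tgt (ginv v) by rewrite src_comp// tgt_inv.
have e3 : src (gcomp s c) = src t by rewrite src_comp.
suff <- : gcomp (gcomp (gcomp s c) (ginv t)) (gcomp (gcomp t d) (ginv v)) =
    gcomp (gcomp s (gcomp c d)) (ginv v).
  by apply: rcompM Cx Cy; rewrite src_comp// src_inv !tgt_comp.
rewrite gcompA ?tgt_comp// ?src_comp// ?src_inv//.
rewrite (@gcompA _ (gcomp (gcomp s c) (ginv t))) ?src_comp ?src_inv//.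
rewrite -(@gcompA _ (gcomp s c)) ?src_inv//.
rewrite gcompVg -e3 gcomp_idr (@gcompA _ s)//.
all: by rewrite tgt_inv.
Qed.

Lemma mx_comp_mul0 c d f g : src c <> tgt d -> mx_comp Sg c f ->
  mx_comp Sg d g -> mx_mul f g = 0.
Proof.
move=> cd [ff Cf] [fg Cg]; apply/funext => i; apply/funext => k.
rewrite (mx_mulE (s := [::])) ?big_nil// => j; case.
have [->|[s [t [Ss St sc tc Cx]]]] := Cf i j; first by rewrite gmul0l.
have [->|[t' [v [St' Sv td vd Cy]]]] := Cg j k; first by rewrite gmul0r.
apply: rcompM0 Cx Cy; rewrite src_comp ?src_comp ?tgt_inv// src_inv.
rewrite tgt_comp ?src_comp ?tgt_inv// tgt_comp// => tt'.
by apply: cd; rewrite -tc -td; congr src; exact: utgt St St' _.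
Qed.

Lemma mx_one_diag e i s : Sg i s -> src s = e ->
  mx_one Sg e i i = gone D (tgt s).
Proof.
move=> Ss se; rewrite /mx_one; case: pselect => [[e' h]|[]] /=; last first.
  by split=> //; exists s.
by case: cid => s' /= [Ss' se']; rewrite (usrc Ss' Ss)// se se'.
Qed.

Lemma mx_one_offdiag e i j : i <> j -> mx_one Sg e i j = 0.
Proof. by move=> ij; rewrite /mx_one; case: pselect => // -[[]]. Qed.

Lemma mx_one_comp e : mx_comp Sg (idn e) (mx_one Sg e).
Proof.
have [_ _ _ _ /(_ e)fin] := mSg; split=> [|i j].
  apply: (sub_finite_set _ (finite_image (fun i => (i, i)) fin)) => -[i j] /=.
  rewrite /mx_one; case: pselect => /= [[ij [s [Ss se]]]|] _ //.
  by exists i; [exists s|rewrite ij].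
have [ij|ij] := pselect (i = j); last by rewrite mx_one_offdiag//; left.
subst j; have [[s [Ss se]]|n] := pselect (exists s, Sg i s /\ src s = e).
  rewrite (mx_one_diag Ss se); right; exists s, s; split=> //.
  - by rewrite tgt_idn.
  - by rewrite src_idn.
  by rewrite -se gcomp_idr gcompV; exact: gone_comp.
by left; rewrite /mx_one; case: pselect => [h|] //=; case: (n h.2).
Qed.

Lemma mx_one_mul c f : mx_comp Sg c f -> mx_mul (mx_one Sg (tgt c)) f = f.
Proof.
move=> [ff Cf]; apply/funext => i; apply/funext => k.
rewrite /mx_mul (@fsum1 _ _ _ i); last first.
  by move=> j ji; rewrite mx_one_offdiag ?gmul0l// => ij; apply: ji.
have [->|[s [t [Ss St sc tc Cx]]]] := Cf i k; first by rewrite gmul0r.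
rewrite (mx_one_diag Ss sc); have := gone_mul Cx.
by rewrite tgt_comp ?src_comp ?tgt_inv// tgt_comp.
Qed.

Lemma mx_mul_one c f : mx_comp Sg c f -> mx_mul f (mx_one Sg (src c)) = f.
Proof.
move=> [ff Cf]; apply/funext => i; apply/funext => k.
rewrite /mx_mul (@fsum1 _ _ _ k); last first.
  by move=> j ji; rewrite mx_one_offdiag ?gmul0r// => ij; apply: ji.
have [->|[s [t [Ss St sc tc Cx]]]] := Cf i k; first by rewrite gmul0l.
rewrite (mx_one_diag St tc); have := gmul_one Cx.
by rewrite src_comp ?src_comp ?tgt_inv// src_inv.
Qed.

Fact mx_laws : gr_laws (mx_comp Sg) mx_mul (mx_one Sg).
Proof.
split.
- exact: mx_comp_subgroup.
- exact: mx_comp_independent.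
- by move=> f g h /mx_span_finite ff /mx_span_finite fg /mx_span_finite; exact: mx_mulA.
- by move=> f g h _ _ /mx_span_finite; exact: mx_mulDl.
- by move=> f g h /mx_span_finite ff _ _; exact: mx_mulDr.
- exact: mx_comp_mul.
- exact: mx_comp_mul0.
- exact: mx_one_comp.
- exact: mx_one_mul.
- exact: mx_mul_one.
Qed.

(* M_I(D)(Σ): the subgroup of matrices spanned by its homogeneous components *)
Definition mx_ring : grRing G := gr_span mx_laws.

End Laws.
End Matrix.

(* Over a division ring supported in eΓe, the singletons of a d-finite
   sequence in eΓ form a matricial sequence. *)
Lemma matricial_singletons (G : groupoid) (D : grRing G) (e : obj G) (I : Type)
    (sg : I -> G) : gr_division D -> supp D `<=` corner e e ->
  (forall i, tgt (sg i) = e) -> d_finite sg ->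
  matricial D (fun i => [set sg i]).
Proof.
move=> [[x x0] _] De sge fin; have [DC _ spanD] := rcomp_direct D.
have De0 : gone D e <> 0.
  move=> e0; apply: x0.
  have : addspan (\bigcup_g rcomp D g) x by rewrite spanD.
  apply: (@addspan_ind _ _ [set 0]).
    by split=> // y z /= -> ->; rewrite subr0.
  move=> y [g _ Cy] /=; apply: contrapT => y0.
  have [|ge _] := De g; first by move=> D0; apply: y0; move: Cy; rewrite D0.
  by apply: y0; rewrite -(gone_mul Cy) ge e0 gmul0l.
split=> [i|i _ _ -> ->//|i _ _ -> ->//|i _ ->|f].
- by exists (sg i).
- by rewrite /obj' /= sge.
- by apply: sub_finite_set (fin f) => i [_ -> <-].
Qed.

Section End.
Variables (G : groupoid) (D : grRing G) (V : grMod D).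
Implicit Types (a b : V -> V).

Definition end_comp (g : G) : set (V -> V) :=
  [set f | [/\ forall v w, f (v + w) = f v + f w,
               forall v c, f (gact v c) = gact (f v) c,
               forall s v, src g = tgt s -> mcomp V s v ->
                 mcomp V (gcomp g s) (f v) &
               forall s v, src g <> tgt s -> mcomp V s v -> f v = 0]].

Let dV := mcomp_direct V.

Definition end_one (e : obj G) : V -> V := hpart dV [set g | tgt g = e].

Definition end_mul (f g : V -> V) : V -> V := f \o g.

Lemma additiveB a : (forall v w, a (v + w) = a v + a w) ->
  {morph a : x y / x - y}.
Proof. by move=> aD x y; have := aD (x - y) y; rewrite subrK => ->; rewrite addrK. Qed.

Lemma morphBD a : {morph a : x y / x - y} ->
  forall v w, a (v + w) = a v + a w.
Proof.
by move=> aB v w; apply/eqP; rewrite -subr_eq -aB addrK.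
Qed.

Lemma end_compB g f : end_comp g f -> {morph f : x y / x - y}.
Proof. by case=> fD _ _ _; exact: additiveB. Qed.

Lemma end_comp_subgroup g : subgroup (end_comp g).
Proof.
have [VC _ _] := dV; split=> [|a b [aD aL aM aO] [bD bL bM bO]]; split.
- by move=> v w; exact/esym/addr0.
- by move=> v c; exact/esym/(morphB0 (gactBl c)).
- by move=> s v _ _; exact: (VC _).1.
- by [].
- by move=> v w; rewrite !fctE aD bD opprD addrACA.
- by move=> v c; rewrite !fctE aL bL gactBl.
- by move=> s v gs Cv; apply: (VC _).2; [exact: aM|exact: bM].
- move=> s v gs Cv; have := aO s v gs Cv; have := bO s v gs Cv.
  by rewrite !fctE => -> ->; rewrite subrr.
Qed.

Lemma comp_cancelr (g h s : G) : src g = tgt s -> src h = tgt s ->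
  gcomp g s = gcomp h s -> g = h.
Proof.
have key k : src k = tgt s -> gcomp (gcomp k s) (ginv s) = k.
  by move=> ks; rewrite -gcompA ?tgt_inv// gcompV -ks gcomp_idr.
by move=> gs hs e; rewrite -(key g)// e key.
Qed.

Lemma end_comp_independent : independent end_comp.
Proof.
move=> a fa Ca a0 g.
have [aD aL aM aO] := Ca g.
apply: (direct_ind dV) => [|x y|s v Cv]; first exact: end_compB (Ca g).
  exact/esym/subr0.
have [gs|] := pselect (src g = tgt s); last by move=> gs; exact: aO Cv.
pose P := [set gcomp g s].
have : hpart dV P (fsum a v) = 0 by rewrite a0 (morphB0 (hpartB dV P)).
have [S [uS Sa]] := finite_set_seq fa.
have [gS|gS] := boolP ((g : {classic G}) \in S); last first.
  have -> : a g = 0 by apply: contrapT => /Sa; apply/negP.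
  by [].
have -> : fsum a v = \sum_(d <- S) a d v.
  by rewrite (@fsumE _ _ a S)// !fct_sumE.
rewrite (morphB_sum _ _ (hpartB dV P)).
rewrite (@bigD1_seq _ _ _ {classic G} S g)//= (hpart_id _ _ (aM s v gs Cv))//.
rewrite big1 ?addr0// => d /eqP dg.
have [_ _ dM dO] := Ca d.
have [ds|ds] := pselect (src d = tgt s); last first.
  by rewrite (dO s)//; exact: (morphB0 (hpartB _ P)).
apply: hpart_0 (dM s v ds Cv); rewrite /P /= => e.
by apply: dg; exact: comp_cancelr e.
Qed.

Lemma end_span_additive f : addspan (\bigcup_g end_comp g) f ->
  forall v w, f (v + w) = f v + f w.
Proof.
move: f; apply: addspan_ind => [|f [g _ []]//].
split=> [v w|a b aD bD v w]; first exact/esym/addr0.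
by rewrite !fctE aD bD opprD addrACA.
Qed.

Lemma end_comp_mul g h a b : src g = tgt h -> end_comp g a -> end_comp h b ->
  end_comp (gcomp g h) (end_mul a b).
Proof.
move=> gh [aD aL aM aO] [bD bL bM bO]; rewrite /end_mul.
have a0 := morphB0 (additiveB aD).
split=> [v w|v c|s v gs Cv|s v gs Cv] /=.
- by rewrite bD aD.
- by rewrite bL aL.
- move: gs; rewrite src_comp// => hs; rewrite -gcompA//.
  by apply: aM; [rewrite tgt_comp|exact: bM].
- by move: gs; rewrite src_comp// => hs; rewrite (bO s)// a0.
Qed.

Lemma end_comp_mul0 g h a b : src g <> tgt h -> end_comp g a ->
  end_comp h b -> end_mul a b = 0.
Proof.
move=> gh Ca Cb; have aB := end_compB Ca; have bB := end_compB Cb.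
apply: (direct_ind dV) => [x y|x y|s v Cv]; rewrite /end_mul /=.
- by rewrite bB aB.
- exact/esym/subr0.
- have [_ _ _ aO] := Ca; have [_ _ bM bO] := Cb.
  have [hs|hs] := pselect (src h = tgt s).
    by apply: aO (bM s v hs Cv); rewrite tgt_comp.
  by rewrite (bO s)// (morphB0 aB).
Qed.

Lemma end_one_comp e : end_comp (idn e) (end_one e).
Proof.
rewrite /end_one; set P := [set g | _].
have pB := hpartB dV P; have p0 := morphB0 pB.
split=> [v w|v c|s v es Cv|s v es Cv].
- exact: morphBD.
- suff E : (fun c => hpart dV P (gact v c)) = (fun c => gact (hpart dV P v) c).
    by rewrite -[LHS]/((fun c => hpart dV P (gact v c)) c) E.
  apply: (direct_ind (rcomp_direct D)) => [x y|x y|h d Cd] /=.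
  + by rewrite gactBr pB.
  + by rewrite gactBr.
  + suff E : (fun v => hpart dV P (gact v d)) = (fun v => gact (hpart dV P v) d).
      by rewrite -[LHS]/((fun v => hpart dV P (gact v d)) v) E.
    apply: (direct_ind dV) => [x y|x y|s w Cw] /=.
    * by rewrite gactBl pB.
    * by rewrite pB gactBl.
    * have [sh|sh] := pselect (src s = tgt h); have [Ps|Ps] := pselect (P s).
      - by rewrite (hpart_id dV Ps Cw) (hpart_id dV _ (mcompM sh Cw Cd))// /P /= tgt_comp.
      - rewrite (hpart_0 dV Ps Cw) (hpart_0 dV _ (mcompM sh Cw Cd)).
          by rewrite (morphB0 (gactBl d)).
        by rewrite /P /= tgt_comp.
      - by rewrite (hpart_id dV Ps Cw) (mcompM0 sh Cw Cd) p0.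
      - by rewrite (hpart_0 dV Ps Cw) (mcompM0 sh Cw Cd) p0 (morphB0 (gactBl d)).
- move: es; rewrite src_idn => es; rewrite es gcomp_idl.
  by rewrite (hpart_id dV _ Cv).
- by apply: hpart_0 Cv; move: es; rewrite src_idn /P /= => es se; apply: es.
Qed.

Lemma end_one_mul g a : end_comp g a -> end_mul (end_one (tgt g)) a = a.
Proof.
move=> Ca; have aB := end_compB Ca; have pB := hpartB dV [set h | tgt h = tgt g].
apply: (direct_ind dV) => // [x y|s v Cv]; rewrite /end_mul /end_one /=.
  by rewrite aB pB.
have [_ _ aM aO] := Ca; have [gs|gs] := pselect (src g = tgt s).
  by rewrite (hpart_id dV _ (aM s v gs Cv))//= tgt_comp.
by rewrite (aO s)// (morphB0 pB).
Qed.

Lemma end_mul_one g a : end_comp g a -> end_mul a (end_one (src g)) = a.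
Proof.
move=> Ca; have aB := end_compB Ca; have pB := hpartB dV [set h | tgt h = src g].
apply: (direct_ind dV) => // [x y|s v Cv]; rewrite /end_mul /end_one /=.
  by rewrite pB aB.
have [_ _ aM aO] := Ca; have [gs|gs] := pselect (src g = tgt s).
  by rewrite (hpart_id dV _ Cv).
by rewrite (aO s v gs Cv) (hpart_0 dV _ Cv) ?(morphB0 aB)//= => e; apply: gs.
Qed.

Fact end_laws : gr_laws end_comp end_mul end_one.
Proof.
split.
- exact: end_comp_subgroup.
- exact: end_comp_independent.
- by [].
- by [].
- move=> f g h /end_span_additive fD _ _; apply/funext => v; exact: fD.
- exact: end_comp_mul.
- exact: end_comp_mul0.
- exact: end_one_comp.
- exact: end_one_mul.
- exact: end_mul_one.
Qed.

(* END_D(V): the subgroup of D-endomorphisms spanned by the homogeneous ones *)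
Definition end_ring : grRing G := gr_span end_laws.

End End.

(* Main.v *)
Require Import Defs.
From mathcomp Require Import all_boot all_algebra.
From mathcomp Require Import boolp classical_sets functions cardinality fsbigop.

Set Implicit Arguments.
Unset Strict Implicit.
Unset Printing Implicit Defensive.
Import GRing.Theory.
Local Open Scope classical_set_scope.
Local Open Scope ring_scope.

(** A single property of [R] carries all five conditions, [has_division_frame]:
    there is a homogeneous idempotent [eps], of degree the identity of an
    object [e], whose corner [eps R eps] is a graded division ring, and for
    every object [f] the identity [1_f] is a finite sum of products [x i y i]
    with [x i] in [R eps] and [y i] in [eps R] homogeneous and
    [y i x j = delta_ij eps].  The products [x i a y j], with [a] in the
    corner, are then matrix units for [R], so [R] can be read off as a matrix
    ring or as an endomorphism ring.

    A gr-simple [Gamma_0]-artinian ring has a frame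
    ([simple_artinian_frame]).  Gr-simplicity is used through primeness: any
    two nonzero homogeneous elements [a], [b] satisfy [a c b <> 0] for some
    homogeneous [c].  A minimal graded right ideal is generated by an
    idempotent [eps] (Brauer), and Schur's lemma makes its corner a division
    ring.  As long as a partial sum of products [x i y i] leaves a nonzero
    idempotent [u] in [1_f R 1_f], primeness produces one more pair inside [u];
    the chain condition on right ideals of [1_f R] stops this.  Conversely
    ([frame_simple_artinian]) a frame brings [eps], and hence every [1_f], into
    any nonzero graded ideal, and a right ideal of [1_f R] is determined, within
    a larger one, by the finite set of its leading indices, as in Gaussian
    elimination.

    From a frame, [r |-> (y i r x j)] is an isomorphism onto a matrix ring over
    the corner ([iso_mx_ring]), and left multiplication on [R eps] is an
    isomorphism onto an endomorphism ring ([iso_end_ring]).  The corner is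
    supported on the loops at [e], which makes it gr-prime
    ([corner_division_prime]).

    It remains to find frames in [M_I(D)(Sigma)] and in [END_D(V)] for a
    gr-prime division ring [D].  Both contain matrix units with coefficients in
    [D] ([mx_matrix_units], [end_matrix_units]), indexed by pairs of an index
    [i] and an element of [Sigma_i] in the first case, by a pseudo-basis of [V]
    in the second.  The units live over several objects of [D]; since [D] is
    gr-prime these objects are linked by invertible homogeneous elements, which
    move all units to a single corner ([units_frame]). *)

(** * Cancellation in groupoids *)

Section GroupoidTheory.
Variable G : groupoid.
Implicit Types g h k : G.

Lemma gcompK g h : src g = tgt h -> gcomp (gcomp g h) (ginv h) = g.
Proof. by move=> gh; rewrite -gcompA ?tgt_inv// gcompV -gh gcomp_idr. Qed.

Lemma gcompKV g h : src g = src h -> gcomp (gcomp g (ginv h)) h = g.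
Proof.
by move=> gh; rewrite -gcompA ?tgt_inv ?src_inv// gcompVg -gh gcomp_idr.
Qed.

Lemma gcompVK g h : src g = tgt h -> gcomp (ginv g) (gcomp g h) = h.
Proof. by move=> gh; rewrite gcompA ?src_inv// gcompVg gh gcomp_idl. Qed.

Lemma gcompKl g h : tgt g = tgt h -> gcomp g (gcomp (ginv g) h) = h.
Proof.
by move=> gh; rewrite gcompA ?src_inv ?tgt_inv// gcompV gh gcomp_idl.
Qed.

Lemma ginv_uniq g h : src g = tgt h -> gcomp g h = idn (tgt g) -> h = ginv g.
Proof.
move=> gh ghE; rewrite -(gcompVK gh) ghE.
by rewrite -(src_inv g) gcomp_idr.
Qed.

Lemma ginvK g : ginv (ginv g) = g.
Proof. by apply/esym/ginv_uniq; rewrite ?src_inv// tgt_inv gcompVg. Qed.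

Lemma ginv_comp g h :
  src g = tgt h -> ginv (gcomp g h) = gcomp (ginv h) (ginv g).
Proof.
move=> gh; apply/esym/ginv_uniq; first by rewrite src_comp// tgt_comp ?tgt_inv// src_inv.
rewrite gcompA ?tgt_inv ?src_inv ?src_comp// gcompK// gcompV.
by rewrite tgt_comp.
Qed.

Lemma gcompIl g h k : src g = tgt h -> src g = tgt k ->
  gcomp g h = gcomp g k -> h = k.
Proof. by move=> gh gk E; rewrite -(gcompVK gh) E gcompVK. Qed.

End GroupoidTheory.

(** * Graded subgroups *)

Lemma morphB_add (A B : zmodType) (f : A -> B) : {morph f : x y / x - y} ->
  forall x y, f (x + y) = f x + f y.
Proof. by move=> fB x y; apply/eqP; rewrite -subr_eq -fB addrK. Qed.

Lemma add_morphB (A B : zmodType) (f : A -> B) :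
  (forall x y, f (x + y) = f x + f y) -> {morph f : x y / x - y}.
Proof.
by move=> fD x y; have := fD (x - y) y; rewrite subrK => ->; rewrite addrK.
Qed.

Section GradedSets.
Variables (T : Type) (A : zmodType) (C : T -> set A).
Implicit Types N X : set A.

Lemma addspan_graded X : (forall x, X x -> exists t, C t x) ->
  graded_set C (addspan X).
Proof.
move=> XC; apply/seteqP; split.
  apply: addspan_ind; first exact: addspan_subgroup.
  move=> x Xx; apply: addspan_sub; have [t Ctx] := XC x Xx.
  by exists t => //; split=> //; exact: addspan_sub.
apply: addspan_ind; first exact: addspan_subgroup.
by move=> x [t _ []].
Qed.

Lemma graded_homogeneous N x : graded_set C N -> N x -> x <> 0 ->
  exists t a, [/\ N a, C t a & a <> 0].
Proof.
move=> gN; rewrite {1}gN => Nx x0; apply: contrapT => n; apply: x0; move: Nx.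
apply: (@addspan_ind _ _ [set 0]) => [|a [t _ [Na Ca]]].
  by split=> // y z -> ->; rewrite /= subr0.
by apply: contrapT => a0; apply: n; exists t, a.
Qed.

Lemma graded_hpart (dC : direct_sum C) N (P : set T) x :
  subgroup N -> graded_set C N -> N x -> N (hpart dC P x).
Proof.
move=> sN gN; rewrite {1}gN => Nx; suff: [set x | N (hpart dC P x)] x by [].
move: x Nx; apply: addspan_ind => [|a [t _ [Na Ca]]] /=.
  split=> [|y z Ny Nz] /=; first by rewrite (morphB0 (hpartB dC P)); exact: sN.1.
  by rewrite hpartB; exact: sN.2.
have [Pt|Pt] := pselect (P t); first by rewrite (hpart_id dC Pt Ca).
by rewrite (hpart_0 dC Pt Ca); exact: sN.1.
Qed.

Lemma direct_span (dC : direct_sum C) x : addspan (\bigcup_t C t) x.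
Proof. by case: dC => _ _ ->. Qed.

Lemma graded_setT : direct_sum C -> graded_set C setT.
Proof.
move=> dC; apply/seteqP; split=> // x _; have := direct_span dC x.
by congr (addspan _ x); apply: eq_bigcupr => t _; rewrite setTI.
Qed.

Lemma direct_ext (dC : direct_sum C) (B : zmodType) (f g : A -> B) :
  {morph f : x y / x - y} -> {morph g : x y / x - y} ->
  (forall t x, C t x -> f x = g x) -> forall x, f x = g x.
Proof. by move=> fB gB fg x; rewrite (direct_ind dC fB gB fg). Qed.

End GradedSets.

(** * Elementary calculus in graded rings *)

Section RingTheory.
Variables (G : groupoid) (R : grRing G).
Implicit Types (a b c x y : R) (g h : G) (e f : obj G).

Lemma rcomp0 g : rcomp R g 0.
Proof. by have [sC _ _] := rcomp_direct R; exact: (sC g).1. Qed.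

Lemma rcompB g a b : rcomp R g a -> rcomp R g b -> rcomp R g (a - b).
Proof. by have [sC _ _] := rcomp_direct R; exact: (sC g).2. Qed.

Lemma rcomp_sum g (I : Type) (r : seq I) (F : I -> R) :
  (forall i, rcomp R g (F i)) -> rcomp R g (\sum_(i <- r) F i).
Proof.
by have [sC _ _] := rcomp_direct R => CF; exact: (subgroup_sum _ (sC g)).
Qed.

Lemma rcomp_eq g h a : g = h -> rcomp R g a -> rcomp R h a.
Proof. by move=> ->. Qed.

Lemma gmul_suml (I : Type) (r : seq I) (F : I -> R) a :
  gmul (\sum_(i <- r) F i) a = \sum_(i <- r) gmul (F i) a.
Proof. exact: (morphB_sum r F (gmulBl a)). Qed.

Lemma gmul_sumr (I : Type) (r : seq I) (F : I -> R) a :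
  gmul a (\sum_(i <- r) F i) = \sum_(i <- r) gmul a (F i).
Proof. exact: (morphB_sum r F (gmulBr a)). Qed.

Lemma gmul_neq0 g h a b : rcomp R g a -> rcomp R h b -> gmul a b <> 0 ->
  src g = tgt h.
Proof. by move=> Ca Cb ab; apply: contrapT => gh; apply: ab; exact: rcompM0 gh Ca Cb. Qed.

Lemma gone_gone e : gmul (gone R e) (gone R e) = gone R e.
Proof. by have := gone_mul (gone_comp R e); rewrite tgt_idn. Qed.

Lemma gone_mul0 e g a : rcomp R g a -> tgt g <> e -> gmul (gone R e) a = 0.
Proof.
move=> Ca ge; apply: rcompM0 (gone_comp R e) Ca.
by rewrite src_idn => eg; exact: ge.
Qed.

Lemma gmul_one0 e g a : rcomp R g a -> src g <> e -> gmul a (gone R e) = 0.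
Proof.
by move=> Ca ge; apply: rcompM0 Ca (gone_comp R e); rewrite tgt_idn.
Qed.

Lemma tgt_neq0 e g a : rcomp R g a -> a <> 0 -> gmul (gone R e) a = a ->
  tgt g = e.
Proof.
by move=> Ca a0 ea; apply: contrapT => /(gone_mul0 Ca); rewrite ea.
Qed.

Lemma ring_ext (B : zmodType) (f h : R -> B) :
  {morph f : x y / x - y} -> {morph h : x y / x - y} ->
  (forall g x, rcomp R g x -> f x = h x) -> forall x, f x = h x.
Proof. exact: (direct_ext (rcomp_direct R)). Qed.

Lemma exists_homogeneous x : x <> 0 -> exists g a, rcomp R g a /\ a <> 0.
Proof.
move=> x0.
have [g [a [_ Ca a0]]] :=
  graded_homogeneous (graded_setT (rcomp_direct R)) (I : setT x) x0.
by exists g, a.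
Qed.

Lemma gmul_homogeneous_neq0 a x b : gmul (gmul a x) b <> 0 ->
  exists g c, rcomp R g c /\ gmul (gmul a c) b <> 0.
Proof.
move=> axb; apply: contrapT => n; apply: axb.
apply: (@ring_ext _ (fun x => gmul (gmul a x) b) (fun=> 0)) => [y z|y z|g c Cc].
- by rewrite gmulBr gmulBl.
- by rewrite subr0.
- by apply: contrapT => acb; apply: n; exists g, c.
Qed.

Lemma gone_neq0 g a : rcomp R g a -> a <> 0 -> gone R (tgt g) <> 0.
Proof. by move=> Ca a0 e0; apply: a0; rewrite -(gone_mul Ca) e0 gmul0l. Qed.

Definition right_ideal (N : set R) : Prop :=
  [/\ subgroup N, forall x a, N x -> N (gmul x a) & graded_set (rcomp R) N].

Lemma right_idealP (N : set R) :
  right_ideal N <-> @graded_submodule _ _ (regular R) N.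
Proof. by split=> [[sN mN gN]|[[sN mN] gN]]; split=> //; split. Qed.

Lemma right_idealT : right_ideal setT.
Proof. by split=> //; exact: graded_setT (rcomp_direct R). Qed.

Lemma right_ideal_image g a (N : set R) : rcomp R g a -> right_ideal N ->
  right_ideal (gmul a @` N).
Proof.
move=> Ca [sN mN gN].
have sI : subgroup (gmul a @` N).
  split=> [|_ _ [x Nx <-] [y Ny <-]]; first by exists 0; [exact: sN.1|exact: gmul0r].
  by exists (x - y); [exact: sN.2|exact: gmulBr].
split=> //.
  by move=> _ b [x Nx <-]; exists (gmul x b); [exact: mN|exact: gmulA].
apply/seteqP; split; last first.
  by apply: addspan_ind => // x [h _ []].
move=> _ [x Nx <-].
suff : [set x | addspan (\bigcup_h ((gmul a @` N) `&` rcomp R h)) (gmul a x)] x by [].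
move: Nx; rewrite {1}gN; move: x; apply: addspan_ind => [|x [h _ [Nx Cx]]].
  have [S0 SB] := addspan_subgroup (\bigcup_h ((gmul a @` N) `&` rcomp R h)).
  split=> [|x y Sx Sy]; first by rewrite /= gmul0r.
  by rewrite /= gmulBr; exact: SB.
have [gh|gh] := pselect (src g = tgt h).
  apply: addspan_sub; exists (gcomp g h) => //; split; first by exists x.
  exact: rcompM gh Ca Cx.
by rewrite /= (rcompM0 gh Ca Cx); exact: (addspan_subgroup _).1.
Qed.

(** A solution of a homogeneous equation may be replaced by its component of
    the appropriate degree. *)
Lemma homogeneous_solution g h a b (N : set R) :
  rcomp R g a -> rcomp R h b -> right_ideal N -> tgt g = tgt h ->
  (gmul a @` N) b -> exists c, [/\ N c, rcomp R (gcomp (ginv g) h) c & gmul a c = b].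
Proof.
move=> Ca Cb [sN mN gN] gh [c Nc acb].
pose k := gcomp (ginv g) h.
have gk : gcomp g k = h by rewrite /k gcompKl.
have sgk : src g = tgt k by rewrite /k tgt_comp ?src_inv ?tgt_inv.
pose dR := rcomp_direct R.
exists (hpart dR [set k] c); split.
- exact: graded_hpart.
- apply: subgroup_fsum; first by have [sC _ _] := dR; exact: sC.
  move=> t; case: pselect => [tk|_] /=; last exact: rcomp0.
  by have [_ Cc _] := hcompP dR c; have := Cc t; rewrite tk.
- rewrite -[RHS](@hpart_id _ _ _ dR [set h] h b)// -acb.
  apply: (@ring_ext _ (fun x => gmul a (hpart dR [set k] x))
    (fun x => hpart dR [set h] (gmul a x))) => [x y|x y|t x Cx].
  + by rewrite hpartB gmulBr.
  + by rewrite gmulBr hpartB.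
  + have [gt|gt] := pselect (src g = tgt t); last first.
      rewrite (rcompM0 gt Ca Cx) (morphB0 (hpartB dR _)).
      rewrite (@hpart_0 _ _ _ dR [set k] t) ?gmul0r//= => tk.
      by apply: gt; rewrite tk.
    have Cax := rcompM gt Ca Cx.
    have [tk|tk] := pselect (t = k).
      rewrite (@hpart_id _ _ _ dR [set k] t)//.
      by rewrite (@hpart_id _ _ _ dR [set h] _ _ _ Cax)//= tk.
    rewrite (@hpart_0 _ _ _ dR [set k] t)// gmul0r.
    rewrite (@hpart_0 _ _ _ dR [set h] _ _ _ Cax)//= => gth; apply: tk.
    by apply: (@gcompIl _ g) => //; rewrite gk.
Qed.

End RingTheory.

(** * Primeness and chain conditions *)

Section Primeness.
Variables (G : groupoid) (R : grRing G).
Implicit Types (a b c x y : R) (g h : G) (e f : obj G) (I J : set R).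

Definition principal_ideal b : set R :=
  addspan [set x | exists g h r s,
    [/\ rcomp R g r, rcomp R h s & x = gmul (gmul r b) s]].

Lemma principal_ideal_gr g b : rcomp R g b -> gr_ideal (principal_ideal b).
Proof.
move=> Cb; pose X := [set x | exists g h r s,
    [/\ rcomp R g r, rcomp R h s & x = gmul (gmul r b) s]].
have [S0 SB] := addspan_subgroup X.
have left_ k a x : rcomp R k a -> addspan X x -> addspan X (gmul a x).
  move=> Ca; move: x; apply: addspan_ind => [|_ [g1 [h1 [r [s [Cr Cs ->]]]]]].
    by split=> [|x y Sx Sy] /=; rewrite ?gmul0r// gmulBr; exact: SB.
  have [kg|kg] := pselect (src k = tgt g1).
    apply: addspan_sub; exists (gcomp k g1), h1, (gmul a r), s.
    by split=> //; [exact: rcompM|rewrite !gmulA].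
  by rewrite /= !gmulA (rcompM0 kg Ca Cr) !gmul0l.
have right_ k a x : rcomp R k a -> addspan X x -> addspan X (gmul x a).
  move=> Ca; move: x; apply: addspan_ind => [|_ [g1 [h1 [r [s [Cr Cs ->]]]]]].
    by split=> [|x y Sx Sy] /=; rewrite ?gmul0l// gmulBl; exact: SB.
  have [kg|kg] := pselect (src h1 = tgt k).
    apply: addspan_sub; exists g1, (gcomp h1 k), r, (gmul s a).
    by split=> //; [exact: rcompM|rewrite !gmulA].
  by rewrite /= -!gmulA (rcompM0 kg Cs Ca) !gmul0r.
split; first exact: addspan_subgroup.
- move=> a x Sx; have := direct_span (rcomp_direct R) a; move: a.
  apply: addspan_ind => [|a [k _ Ca]]; last exact: left_ Ca Sx.
  by split=> [|c d Sc Sd] /=; rewrite ?gmul0l// gmulBl; exact: SB.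
- move=> x a Sx; have := direct_span (rcomp_direct R) a; move: a.
  apply: addspan_ind => [|a [k _ Ca]]; last exact: right_ Ca Sx.
  by split=> [|c d Sc Sd] /=; rewrite ?gmul0r// gmulBr; exact: SB.
apply: addspan_graded => _ [g1 [h1 [r [s [Cr Cs ->]]]]].
have [kg|kg] := pselect (src g1 = tgt g); last first.
  by exists g; rewrite (rcompM0 kg Cr Cb) gmul0l; exact: rcomp0.
have [kh|kh] := pselect (src (gcomp g1 g) = tgt h1); last first.
  exists g; rewrite (rcompM0 kh _ Cs); first exact: rcomp0.
  exact: rcompM.
by exists (gcomp (gcomp g1 g) h1); apply: rcompM => //; exact: rcompM.
Qed.

Lemma principal_ideal_mem g b : rcomp R g b -> principal_ideal b b.
Proof.
move=> Cb; apply: addspan_sub.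
exists (idn (tgt g)), (idn (src g)), (gone R (tgt g)), (gone R (src g)).
by split; [exact: gone_comp|exact: gone_comp|rewrite (gone_mul Cb) (gmul_one Cb)].
Qed.

Definition elementwise_prime : Prop := forall g h a b,
  rcomp R g a -> rcomp R h b -> a <> 0 -> b <> 0 ->
  exists k c, rcomp R k c /\ gmul (gmul a c) b <> 0.

Lemma gr_prime_elementwise : gr_prime R -> elementwise_prime.
Proof.
move=> pR g h a b Ca Cb a0 b0; apply: contrapT => n.
have nz k c : rcomp R k c -> c <> 0 -> principal_ideal c <> [set 0].
  by move=> Cc c0 E; apply: c0; have := principal_ideal_mem Cc; rewrite E.
apply: (pR _ _ (principal_ideal_gr Ca) (principal_ideal_gr Cb) (nz _ _ Ca a0)
  (nz _ _ Cb b0)).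
have s0 : subgroup [set (0 : R)].
  by split=> // x y -> ->; rewrite /= subr0.
have acb c : gmul (gmul a c) b = 0.
  by apply: contrapT => /gmul_homogeneous_neq0[k [d Cd]]; apply: n; exists k, d.
apply/seteqP; split; last by move=> x ->; exact: (addspan_subgroup _).1.
apply: addspan_ind => // _ [x Ix [y Jy <-]].
move: x Ix; apply: addspan_ind => [|_ [g1 [h1 [r [s [Cr Cs ->]]]]]] /=.
  by split=> [|x1 x2 /= E1 E2]; rewrite /= ?gmul0l// gmulBl E1 E2 subr0.
move: y Jy; apply: addspan_ind => [|_ [g2 [h2 [r' [s' [Cr' Cs' ->]]]]]] /=.
  by split=> [|x1 x2 /= E1 E2]; rewrite /= ?gmul0r// gmulBr E1 E2 subr0.
have := acb (gmul s r'); rewrite -!gmulA => E.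
have -> : gmul a (gmul s (gmul r' (gmul b s'))) =
    gmul (gmul a (gmul s (gmul r' b))) s' by rewrite !gmulA.
by rewrite E gmul0l gmul0r.
Qed.

Lemma gr_simple_prime : gr_simple R -> gr_prime R.
Proof.
move=> [[x x0] sR] I J gI gJ I0 J0.
have [//|->] := sR _ gI; have [//|->] := sR _ gJ.
have [g [a [Ca a0]]] := exists_homogeneous x0 => E; apply: a0.
have : ideal_prod setT setT a.
  by apply: addspan_sub; exists a => //; exists (gone R (src g)) => //; exact: gmul_one.
by rewrite E.
Qed.

(** Descending chains give minimal elements by dependent choice: a family
    without a minimal member would contain a strictly decreasing sequence. *)
Lemma artinian_minimal e (Q : set (set R)) : obj_artinian R -> Q !=set0 ->
  (forall N, Q N -> right_ideal N /\ N `<=` range (gmul (gone R e))) ->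
  exists2 N, Q N & forall N', Q N' -> N' `<=` N -> N' = N.
Proof.
move=> aR [N0 QN0] QP; apply: contrapT => n.
have step (N : {N | Q N}) : exists N' : {N | Q N},
    sval N' `<=` sval N /\ sval N' <> sval N.
  case: N => N QN /=; apply: contrapT => n'; apply: n; exists N => // N' QN' NN'.
  by apply: contrapT => NE; apply: n'; exists (exist _ N' QN').
have [next nextP] := choice step.
pose chain k := iter k next (exist _ N0 QN0).
have [k|k|k /(_ k.+1 (leqnSn k))] := aR e (fun k => sval (chain k)).
- have [rN sN] := QP _ (svalP (chain k)).
  by split; [apply/right_idealP|rewrite fiber_regular].
- by have [] := nextP (chain k).
- by have [_] := nextP (chain k).
Qed.

Lemma range_one_sub g a : rcomp R g a ->
  range (gmul a) `<=` range (gmul (gone R (tgt g))).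
Proof. by move=> Ca _ [x _ <-]; exists (gmul a x) => //; rewrite gmulA (gone_mul Ca). Qed.

End Primeness.

(** * Division corners and frames *)

Section Frames.
Variables (G : groupoid) (R : grRing G).
Implicit Types (a b c x y : R) (g h : G) (e f : obj G).

Lemma rcomp_idl e g u a :
  rcomp R (idn e) u -> rcomp R g a -> rcomp R g (gmul u a).
Proof.
move=> Cu Ca; have [eg|eg] := pselect (src (idn e) = tgt g).
  have := rcompM eg Cu Ca; move: eg; rewrite src_idn => ->.
  by rewrite gcomp_idl.
by rewrite (rcompM0 eg Cu Ca); exact: rcomp0.
Qed.

Lemma rcomp_idr e g u a :
  rcomp R (idn e) u -> rcomp R g a -> rcomp R g (gmul a u).
Proof.
move=> Cu Ca; have [eg|eg] := pselect (src g = tgt (idn e)).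
  have := rcompM eg Ca Cu; move: eg; rewrite tgt_idn => <-.
  by rewrite gcomp_idr.
by rewrite (rcompM0 eg Ca Cu); exact: rcomp0.
Qed.

(** The corner [eps R eps] at a homogeneous idempotent is a graded division
    ring, expressed inside [R]. *)
Definition division_corner e (eps : R) : Prop :=
  [/\ rcomp R (idn e) eps, eps <> 0, gmul eps eps = eps &
      forall g a, rcomp R g a -> gmul eps a = a -> gmul a eps = a -> a <> 0 ->
        exists b, [/\ rcomp R (ginv g) b, gmul eps b = b, gmul b eps = b,
                      gmul a b = eps & gmul b a = eps]].

(** A pair of dual families for [R eps] and [eps R]: the elements [x i y j]
    multiply like matrix units, and [x i y i] are orthogonal idempotents of
    degree [idn f]. *)
Definition dual_system (eps : R) e f n (g : 'I_n -> G) (x y : 'I_n -> R) : Prop :=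
  [/\ forall i, src (g i) = e /\ tgt (g i) = f,
      forall i, rcomp R (g i) (x i) /\ gmul (x i) eps = x i,
      forall i, rcomp R (ginv (g i)) (y i) /\ gmul eps (y i) = y i &
      forall i j, gmul (y i) (x j) = if i == j then eps else 0].

Definition complete_system (eps : R) e f n (g : 'I_n -> G) (x y : 'I_n -> R) :=
  dual_system eps e f g x y /\ \sum_(i < n) gmul (x i) (y i) = gone R f.

(** The pivot of all implications: [R] is, object by object, a matrix ring
    over one of its division corners. *)
Definition has_division_frame : Prop := exists e eps,
  division_corner e eps /\
  forall f, exists n (g : 'I_n -> G) (x y : 'I_n -> R),
    complete_system eps e f g x y.

Lemma corner_degree e eps g a : division_corner e eps -> rcomp R g a ->
  a <> 0 -> gmul eps a = a -> gmul a eps = a -> tgt g = e /\ src g = e.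
Proof.
move=> [Ce _ _ _] Ca a0 ea ae; split.
  apply/esym; have := gmul_neq0 Ce Ca; rewrite src_idn; apply.
  by rewrite ea.
by have := gmul_neq0 Ca Ce; rewrite tgt_idn; apply; rewrite ae.
Qed.

End Frames.

(** * From gr-simple artinian rings to frames *)

Section SimpleArtinian.
Variables (G : groupoid) (R : grRing G).
Hypotheses (pR : elementwise_prime R) (aR : obj_artinian R).
Implicit Types (a b c x y : R) (g h : G) (e f : obj G).

(** Brauer's lemma.  In a minimal right ideal [M], primeness gives homogeneous
    [y] with [y M] nonzero, so [y M = M]; solving [y eps = y] in degree [idn e]
    yields an idempotent generating [M], and Schur's lemma makes its corner a
    division ring. *)
Lemma exists_division_corner : (exists x : R, x <> 0) ->
  exists e eps, division_corner (R := R) e eps.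
Proof.
move=> [z /exists_homogeneous[g0 [z0 [Cz0 z00]]]].
pose e := tgt g0.
pose Q := [set N : set R | [/\ right_ideal N, N `<=` range (gmul (gone R e)) &
  N <> [set 0]]].
have [||M [rM sM M0] minM] := artinian_minimal (e := e) (Q := Q) aR.
- exists (range (gmul z0)); split.
  + exact: right_ideal_image Cz0 (right_idealT R).
  + exact: range_one_sub.
  + move=> E; apply: z00; have : range (gmul z0) z0.
      by exists (gone R (src g0)) => //; exact: gmul_one.
    by rewrite E.
- by move=> N [rN sN _].
have [sgM mM gM] := rM.
have eM m : M m -> gmul (gone R e) m = m.
  by move=> /sM[w _ <-]; rewrite gmulA gone_gone.
have [w Mw w0] : exists2 w, M w & w <> 0.
  apply: contrapT => n; apply: M0; apply/seteqP; split=> [w Mw|_ ->].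
    by apply: contrapT => w0; apply: n; exists w.
  exact: sgM.1.
have [g [x [Mx Cx x0]]] := graded_homogeneous gM Mw w0.
have ge : tgt g = e by exact: tgt_neq0 Cx x0 (eM _ Mx).
have image_full h a v : rcomp R h a -> M a -> M v -> gmul a v <> 0 ->
    gmul a @` M = M.
  move=> Ca Ma Mv av; have sub : gmul a @` M `<=` M by move=> _ [m Mm <-]; exact: mM.
  apply: minM => //; split.
  - exact: right_ideal_image Ca rM.
  - by move=> t /sub /sM.
  - by move=> E; apply: av; suff: (gmul a @` M) (gmul a v) by rewrite E.
have [k [a [Ca xax]]] := pR Cx Cx x0 x0.
pose y := gmul x a.
have gk : src g = tgt k.
  by apply: gmul_neq0 Cx Ca _ => E; apply: xax; rewrite E gmul0l.
have ke : src k = e.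
  by rewrite -ge -(gmul_neq0 (rcompM gk Cx Ca) Cx xax) src_comp.
have Cy : rcomp R (gcomp g k) y by exact: rcompM.
have My : M y by exact: mM.
have [eps [Meps Ceps yeps]] : exists c,
    [/\ M c, rcomp R (gcomp (ginv (gcomp g k)) (gcomp g k)) c & gmul y c = y].
  by apply: (homogeneous_solution Cy Cy rM) => //; rewrite (image_full _ _ x Cy).
have Ce : rcomp R (idn e) eps by move: Ceps; rewrite gcompVg src_comp// ke.
have gen h b : rcomp R h b -> M b -> b <> 0 -> range (gmul b) = M.
  move=> Cb Mb b0; have sub : range (gmul b) `<=` M by move=> _ [m _ <-]; exact: mM.
  apply: minM => //; split.
  - exact: right_ideal_image Cb (right_idealT R).
  - by move=> t /sub /sM.
  - move=> E; apply: b0; have : range (gmul b) b.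
      by exists (gone R (src h)) => //; exact: gmul_one.
    by rewrite E.
have eps0 : eps <> 0 by move=> E; apply: xax; rewrite -/y -yeps E gmul0r gmul0l.
have epsI : gmul eps eps = eps.
  apply/subr0_eq; apply: contrapT => d0.
  have Mx' : range (gmul (gmul eps eps - eps)) x.
    rewrite (gen (idn e))//.
      by apply: rcompB => //; exact: (rcomp_idl Ce Ce).
    by apply: sgM.2 => //; exact: mM.
  apply: xax; case: Mx' => t _ Ex; rewrite -/y -{}Ex gmulA gmulBr gmulA !yeps subrr.
  exact: gmul0l.
have epsM m : M m -> gmul eps m = m.
  by rewrite -(gen _ _ Ce Meps eps0) => -[t _ <-]; rewrite gmulA epsI.
have rinv h b : rcomp R h b -> gmul eps b = b -> gmul b eps = b -> b <> 0 ->
    exists c, [/\ rcomp R (ginv h) c, gmul eps c = c, gmul c eps = c &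
      gmul b c = eps].
  move=> Cb eb be b0; have Mb : M b by rewrite -eb; exact: mM.
  have th : tgt h = e by apply: tgt_neq0 Cb b0 (eM _ Mb).
  have [c [_ Cc bc]] : exists c, [/\ [set: R] c,
      rcomp R (gcomp (ginv h) (idn e)) c & gmul b c = eps].
    apply: (homogeneous_solution Cb Ce (right_idealT R)); first by rewrite tgt_idn.
    by rewrite (gen h).
  have {}Cc : rcomp R (ginv h) c.
    by apply: rcomp_eq Cc; rewrite -th -(src_inv h) gcomp_idr.
  exists (gmul (gmul eps c) eps); split.
  - by apply: (rcomp_idr Ce); exact: (rcomp_idl Ce).
  - by rewrite !gmulA epsI.
  - by rewrite -!gmulA epsI.
  - by rewrite !gmulA be bc epsI.
exists e, eps; split=> // h b Cb eb be b0.
have [c [Cc ec ce bc]] := rinv h b Cb eb be b0.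
have c0 : c <> 0 by move=> E; apply: eps0; rewrite -bc E gmul0r.
have [d [_ ed _ cd]] := rinv _ c Cc ec ce c0.
exists c; split=> //; suff -> : b = d by [].
by rewrite -be -cd gmulA bc ed.
Qed.

Variables (e : obj G) (eps : R).
Hypothesis divE : division_corner e eps.

Definition residue f n (x y : 'I_n -> R) : R :=
  gone R f - \sum_(i < n) gmul (x i) (y i).

Section Residue.
Variables (f : obj G) (n : nat) (g : 'I_n -> G) (x y : 'I_n -> R).
Hypothesis dxy : dual_system eps e f g x y.
Let u := residue f x y.

Lemma residue_comp : rcomp R (idn f) u.
Proof.
have [gef Cx Cy _] := dxy; apply: rcompB; first exact: gone_comp.
apply: rcomp_sum => i; have [se te] := gef i.
rewrite -te -(gcompV (g i)); apply: rcompM; first by rewrite tgt_inv.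
  by have [] := Cx i.
by have [] := Cy i.
Qed.

Lemma dual_residue i : gmul (y i) u = 0.
Proof.
have [gef Cx Cy yx] := dxy.
rewrite gmulBr gmul_sumr (bigD1 i)//= big1 => [|j ji]; last first.
  by rewrite gmulA yx eq_sym (negPf ji) gmul0l.
rewrite addr0 gmulA yx eqxx; have [Cyi ->] := Cy i.
have -> : gone R f = gone R (src (ginv (g i))) by rewrite src_inv (gef i).2.
by rewrite (gmul_one Cyi) subrr.
Qed.

Lemma residue_dual i : gmul u (x i) = 0.
Proof.
have [gef Cx Cy yx] := dxy.
rewrite gmulBl gmul_suml (bigD1 i)//= big1 => [|j ji]; last first.
  by rewrite -gmulA yx (negPf ji) gmul0r.
rewrite addr0 -gmulA yx eqxx; have [Cxi ->] := Cx i.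
by rewrite -(gef i).2 (gone_mul Cxi) subrr.
Qed.

Lemma residue_idem : gmul u u = u.
Proof.
rewrite {1}/u /residue gmulBl gmul_suml big1 => [|i _]; last first.
  by rewrite -gmulA dual_residue gmul0r.
by rewrite subr0; have := gone_mul residue_comp; rewrite tgt_idn.
Qed.

(** While the residual idempotent [u] is nonzero, primeness provides a
    nonzero [x = u x eps], and then [b] with [eps b x] invertible in the
    corner, so that [x] has a dual [y] supported on [u]. *)
Lemma residue_split : u <> 0 -> exists k x' y', [/\ src k = e /\ tgt k = f,
  rcomp R k x' /\ gmul x' eps = x', rcomp R (ginv k) y' /\ gmul eps y' = y',
  gmul u x' = x' /\ gmul y' u = y' & gmul y' x' = eps].
Proof.
move=> u0; have [Ce eps0 eeps inv] := divE; have Cu := residue_comp.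
have [k [a [Ca uae]]] := pR Cu Ce u0 eps0.
pose x' := gmul (gmul u a) eps.
have Cua := rcomp_idl Cu Ca.
have Cx' : rcomp R k x' by exact: (rcomp_idr Ce).
have kf : tgt k = f.
  rewrite -(gmul_neq0 Cu Ca) ?src_idn// => E.
  by apply: uae; rewrite E gmul0l.
have ke : src k = e by rewrite (gmul_neq0 Cua Ce uae) tgt_idn.
have x'e : gmul x' eps = x' by rewrite /x' -gmulA eeps.
have ux' : gmul u x' = x' by rewrite /x' !gmulA residue_idem.
have x'0 : x' <> 0 := uae.
clearbody x'; have [l [b [Cb ebx]]] := pR Ce Cx' eps0 x'0.
have Ceb := rcomp_idl Ce Cb.
have lk : src l = tgt k := gmul_neq0 Ceb Cx' ebx.
have [d [Cd ed de _ dd]] : exists d, [/\ rcomp R (ginv (gcomp l k)) d,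
    gmul eps d = d, gmul d eps = d, gmul (gmul (gmul eps b) x') d = eps &
    gmul d (gmul (gmul eps b) x') = eps].
  apply: inv (rcompM lk Ceb Cx') _ _ ebx; first by rewrite !gmulA eeps.
  by rewrite -!gmulA x'e.
pose y' := gmul (gmul d b) u.
have te : tgt l = e.
  rewrite -[RHS](src_idn e); apply/esym/(gmul_neq0 Ce Cb) => E.
  by apply: ebx; rewrite E gmul0l.
exists k, x', y'; split=> //.
- split; last by rewrite /y' !gmulA ed.
  apply: (rcomp_idr Cu).
  have dl : src (ginv (gcomp l k)) = tgt l by rewrite src_inv tgt_comp.
  apply: rcomp_eq (rcompM dl Cd Cb).
  by rewrite ginv_comp// gcompKV// src_inv.
- by rewrite /y' -gmulA residue_idem.
- by rewrite /y' -gmulA ux' -{1}de -!gmulA (gmulA eps).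
Qed.

End Residue.

(** A system whose residual idempotent [u] generates the smallest possible
    right ideal is complete: otherwise splitting off [x' y'] from [u] gives a
    strictly smaller one. *)
Lemma exists_complete_system f : exists n (g : 'I_n -> G) (x y : 'I_n -> R),
  complete_system eps e f g x y.
Proof.
have [Ce eps0 eeps inv] := divE.
pose Q := [set N : set R | exists n (g : 'I_n -> G) (x y : 'I_n -> R),
  dual_system eps e f g x y /\ N = range (gmul (residue f x y))].
have [||_ [n [g [x [y [dxy ->]]]]] minu] := artinian_minimal (e := f) (Q := Q) aR.
- exists (range (gmul (residue f (fun _ : 'I_0 => 0 : R) (fun=> 0)))).
  exists 0%N, (fun=> idn f), (fun=> 0), (fun=> 0); split=> //.
  by split=> -[].
- move=> _ [n [g [x [y [dxy ->]]]]]; have Cu := residue_comp dxy; split.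
    exact: right_ideal_image Cu (right_idealT R).
  by have := range_one_sub Cu; rewrite tgt_idn.
exists n, g, x, y; split=> //.
have [gef Cx Cy yx] := dxy.
set u := residue f x y in minu.
apply/esym/subr0_eq; rewrite -/(residue f x y) -/u; apply: contrapT => u0.
have [k [x' [y' [[ke kf] Cx' Cy' [ux' y'u] y'x']]]] := residue_split dxy u0.
pose ext (T : Type) (t : T) (s : 'I_n -> T) (i : 'I_n.+1) :=
  if unlift ord0 i is Some j then s j else t.
have ext0 T (t : T) s : ext T t s ord0 = t by rewrite /ext unlift_none.
have extS T (t : T) s j : ext T t s (lift ord0 j) = s j by rewrite /ext liftK.
have dxy' : dual_system eps e f (ext _ k g) (ext _ x' x) (ext _ y' y).
  split=> [i|i|i|i j].
  - by case: (unliftP ord0 i) => [i'|] ->; rewrite ?ext0 ?extS.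
  - by case: (unliftP ord0 i) => [i'|] ->; rewrite ?ext0 ?extS.
  - by case: (unliftP ord0 i) => [i'|] ->; rewrite ?ext0 ?extS.
  - case: (unliftP ord0 i) => [i'|] ->; case: (unliftP ord0 j) => [j'|] ->;
      rewrite ?ext0 ?extS.
    + by rewrite yx (inj_eq lift_inj).
    + by rewrite -ux' gmulA (dual_residue dxy) gmul0l.
    + by rewrite -y'u -gmulA (residue_dual dxy) gmul0r.
    + by rewrite eqxx.
have resE : residue f (ext _ x' x) (ext _ y' y) = u - gmul x' y'.
  rewrite /residue big_ord_recl !ext0 opprD addrCA addrC; congr (_ - _ - _).
  by apply: eq_bigr => i _; rewrite !extS.
have E : range (gmul (u - gmul x' y')) = range (gmul u).
  apply: minu; first by exists n.+1, (ext _ k g), (ext _ x' x), (ext _ y' y); rewrite resE.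
  move=> _ [t _ <-]; exists (gmul (u - gmul x' y') t) => //.
  by rewrite gmulA gmulBr gmulA ux' (residue_idem dxy).
have : range (gmul u) x' by exists x'.
rewrite -E => -[t _ Et]; apply: eps0; rewrite -y'x' -Et gmulA gmulBr gmulA y'x'.
by rewrite y'u Cy'.2 subrr gmul0l.
Qed.

End SimpleArtinian.

Lemma simple_artinian_frame (G : groupoid) (R : grRing G) :
  gr_simple R -> obj_artinian R -> has_division_frame R.
Proof.
move=> sR aR; have pR := gr_prime_elementwise (gr_simple_prime sR).
have [e [eps divE]] := exists_division_corner pR aR sR.1.
by exists e, eps; split=> // f; exact: exists_complete_system.
Qed.

(** * From frames to gr-simple artinian rings *)

Section FrameTheory.
Variables (G : groupoid) (R : grRing G) (e : obj G) (eps : R).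
Hypothesis divE : division_corner e eps.
Implicit Types (a b c t : R) (g h : G).

Section Expansion.
Variables (f : obj G) (n : nat) (g : 'I_n -> G) (x y : 'I_n -> R).
Hypothesis sxy : complete_system eps e f g x y.

Lemma expand_left h a : rcomp R h a -> tgt h = f ->
  a = \sum_(i < n) gmul (x i) (gmul (y i) a).
Proof.
move=> Ca hf; rewrite -{1}(gone_mul Ca) hf -sxy.2 gmul_suml.
by apply: eq_bigr => i _; rewrite gmulA.
Qed.

Lemma expand_right h a : rcomp R h a -> src h = f ->
  a = \sum_(i < n) gmul (gmul a (x i)) (y i).
Proof.
move=> Ca hf; rewrite -{1}(gmul_one Ca) hf -sxy.2 gmul_sumr.
by apply: eq_bigr => i _; rewrite gmulA.
Qed.

Lemma dual_left_comp h a i : rcomp R h a -> tgt h = f ->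
  rcomp R (gcomp (ginv (g i)) h) (gmul (y i) a).
Proof.
move=> Ca hf; have [[gef _ Cy _] _] := sxy.
by apply: rcompM (Cy i).1 Ca; rewrite src_inv (gef i).2.
Qed.

Lemma dual_right_comp h a i : rcomp R h a -> src h = f ->
  rcomp R (gcomp h (g i)) (gmul a (x i)).
Proof.
move=> Ca hf; have [[gef Cx _ _] _] := sxy.
by apply: rcompM Ca (Cx i).1; rewrite (gef i).2.
Qed.

End Expansion.

Hypothesis full : forall f, exists n (g : 'I_n -> G) (x y : 'I_n -> R),
  complete_system eps e f g x y.

(** [eps R] is a simple right ideal: a nonzero homogeneous [c] in it has a
    nonzero entry [c x j] in the division corner. *)
Lemma corner_right_inverse h c : rcomp R h c -> gmul eps c = c -> c <> 0 ->
  exists b, rcomp R (ginv h) b /\ gmul c b = eps.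
Proof.
move=> Cc ec c0; have [Ce _ _ inv] := divE.
have he : tgt h = e.
  apply/esym; rewrite -[LHS](src_idn e); apply: (gmul_neq0 Ce Cc).
  by rewrite ec.
have [n [g [x [y sxy]]]] := full (src h).
have [[gef Cx Cy yx] _] := sxy.
have [j cx0] : exists j, gmul c (x j) <> 0.
  apply: contrapT => /forallNP nx; apply: c0.
  rewrite (expand_right sxy Cc erefl) big1// => j _.
  by rewrite (contrapT (nx j)) gmul0l.
have Ccx := dual_right_comp sxy j Cc erefl.
have [b [Cb eb _ cxb _]] : exists b, [/\ rcomp R (ginv (gcomp h (g j))) b,
    gmul eps b = b, gmul b eps = b, gmul (gmul c (x j)) b = eps &
    gmul b (gmul c (x j)) = eps].
  by apply: inv Ccx _ _ cx0; rewrite ?gmulA ?ec// -gmulA (Cx j).2.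
exists (gmul (x j) b); rewrite gmulA; split=> //.
have hg : src h = tgt (g j) by rewrite (gef j).2.
apply: rcomp_eq (rcompM _ (Cx j).1 Cb); last first.
  by rewrite tgt_inv src_comp.
by rewrite ginv_comp// gcompKl// tgt_inv.
Qed.

(** A nonzero homogeneous [a] has a nonzero entry [y i a], and
    [y i a b = eps] for some [b]; so the ideal of [a] contains [eps], and then
    [1_f = \sum x i eps y i] for all [f]. *)
Lemma frame_simple : gr_simple R.
Proof.
have [Ce eps0 eeps inv] := divE.
split; first by exists eps.
move=> J [sJ lJ rJ gJ]; have [//|J0] := pselect (J = [set 0]); [by left|right].
have [w Jw w0] : exists2 w, J w & w <> 0.
  apply: contrapT => nw; apply: J0; apply/seteqP; split=> [w Jw|_ ->].
    by apply: contrapT => w0; apply: nw; exists w.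
  exact: sJ.1.
have [h [a [Ja Ca a0]]] := graded_homogeneous gJ Jw w0.
have [n [g [x [y sxy]]]] := full (tgt h).
have [[gef Cx Cy yx] _] := sxy.
have [i ya0] : exists i, gmul (y i) a <> 0.
  apply: contrapT => /forallNP ny; apply: a0.
  rewrite (expand_left sxy Ca erefl) big1// => i _.
  by rewrite (contrapT (ny i)) gmul0r.
have [b [_ yab]] : exists b,
    rcomp R (ginv (gcomp (ginv (g i)) h)) b /\ gmul (gmul (y i) a) b = eps.
  apply: corner_right_inverse ya0; first exact: (dual_left_comp sxy i Ca erefl).
  by rewrite gmulA (Cy i).2.
have Je : J eps by rewrite -yab; apply: rJ; exact: lJ.
have J1 f : J (gone R f).
  have [n' [g' [x' [y' [[_ Cx' _ _] <-]]]]] := full f.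
  apply: subgroup_sum => // j; rewrite -(Cx' j).2.
  by apply: rJ; exact: lJ.
apply/seteqP; split=> // c _; have := direct_span (rcomp_direct R) c; move: c.
apply: addspan_ind => // c [k _ Cc]; rewrite -(gone_mul Cc); exact: rJ.
Qed.

Section LeadingIndices.
Variables (f : obj G) (n : nat) (g : 'I_n -> G) (x y : 'I_n -> R).
Hypothesis sxy : complete_system eps e f g x y.

Definition leading (N : set R) : {set 'I_n} := [set i : 'I_n |
  `[< exists h t, [/\ N t, rcomp R h t, gmul (y i) t <> 0 &
        forall j : 'I_n, (i < j)%N -> gmul (y j) t = 0] >]]%SET.

Lemma leading_mono (N N' : set R) : N' `<=` N -> leading N' \subset leading N.
Proof.
move=> NN; apply/fintype.subsetP => i; rewrite !inE => -[h [t [Nt Ct yt yj]]].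
by exists h, t; split=> //; exact: NN.
Qed.

(** As in Gaussian elimination, a homogeneous [t] in [N] is reduced to zero by
    elements of [N'] with the same leading index, one index at a time. *)
Lemma leading_inj (N N' : set R) : right_ideal N -> right_ideal N' ->
  N `<=` range (gmul (gone R f)) -> N' `<=` N -> leading N \subset leading N' ->
  N = N'.
Proof.
have [[gef Cx Cy yx] _] := sxy.
move=> [sN mN gN] [sN' mN' gN'] Nf NN /fintype.subsetP LL; apply/seteqP; split=> //.
rewrite gN; apply: addspan_ind => // t [h _ [Nt Ct]].
suff red k : (k <= n)%N -> forall t, N t -> rcomp R h t ->
    (forall i : 'I_n, (k <= i)%N -> gmul (y i) t = 0) -> N' t.
  apply: (red n) => // i; by rewrite leqNgt ltn_ord.
elim: k => [_|k IH kn] {Ct}t {}Nt Ct yt.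
  have [->|t0] := pselect (t = 0); first exact: sN'.1.
  have hf : tgt h = f.
    apply: tgt_neq0 Ct t0 _; have [r _ <-] := Nf t Nt.
    by rewrite gmulA gone_gone.
  rewrite (expand_left sxy Ct hf) big1 => [|i _]; first exact: sN'.1.
  by rewrite yt// gmul0r.
pose i := Ordinal kn.
have [yit|yit] := pselect (gmul (y i) t = 0).
  apply: (IH (ltnW kn) t Nt Ct) => j.
  by rewrite leq_eqVlt => /orP[/eqP kj|]; [rewrite -(_ : i = j) //; exact: val_inj|exact: yt].
have hf : tgt h = f.
  apply: (@tgt_neq0 _ _ f _ t) => // [t0|]; first by apply: yit; rewrite t0 gmul0r.
  by have [r _ <-] := Nf t Nt; rewrite gmulA gone_gone.
have : i \in leading N.
  by rewrite !inE; exists h, t; split=> // j ij; exact: yt.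
move=> /LL; rewrite !inE => -[h' [t' [Nt' Ct' yit' yjt']]].
have hf' : tgt h' = f.
  apply: (@tgt_neq0 _ _ f _ t') => // [t0|]; first by apply: yit'; rewrite t0 gmul0r.
  by have [r _ <-] := Nf t' (NN _ Nt'); rewrite gmulA gone_gone.
have [b [Cb cb]] : exists b,
    rcomp R (ginv (gcomp (ginv (g i)) h')) b /\ gmul (gmul (y i) t') b = eps.
  apply: corner_right_inverse yit'; first exact: (dual_left_comp sxy i Ct' hf').
  by rewrite gmulA (Cy i).2.
pose s := gmul (gmul t' b) (gmul (y i) t).
have Ns : N' s by apply: (mN'); exact: mN'.
have Cs : rcomp R h s.
  have gh' : src (ginv (g i)) = tgt h' by rewrite src_inv (gef i).2.
  have Ctb : rcomp R (g i) (gmul t' b).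
    apply: rcomp_eq (rcompM _ Ct' Cb); last by rewrite tgt_inv src_comp.
    by rewrite ginv_comp// ginvK gcompKl// (gef i).2.
  apply: rcomp_eq (rcompM _ Ctb (dual_left_comp sxy i Ct hf)).
    by rewrite gcompKl// (gef i).2.
  by rewrite tgt_comp ?tgt_inv// src_inv (gef i).2.
have -> : t = (t - s) + s by rewrite subrK.
apply: subgroupD => //; apply: (IH (ltnW kn)) => // [||j].
- by apply: sN.2 => //; exact: NN.
- exact: rcompB.
rewrite gmulBr /s !gmulA leq_eqVlt => /orP[/eqP kj|kj].
  rewrite -(_ : i = j); last exact: val_inj.
  by rewrite cb (Cy i).2 subrr.
by rewrite yt// yjt'// !gmul0l subrr.
Qed.

End LeadingIndices.

Lemma frame_artinian : obj_artinian R.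
Proof.
move=> f N NP Ndec; have [n [g [x [y sxy]]]] := full f.
have rN k : right_ideal (N k) by apply/right_idealP; have [] := NP k.
have Nf k : N k `<=` range (gmul (gone R f)) by rewrite -fiber_regular; have [] := NP k.
have anti k l : (k <= l)%N -> N l `<=` N k.
  move=> kl; rewrite -(subnKC kl); elim: (l - k)%N => [|d IH]; first by rewrite addn0.
  by rewrite addnS => t /Ndec /IH.
have exN : exists m, `[< exists k, #|leading y (N k)| = m >].
  by exists #|leading y (N 0%N)|; apply/asboolP; exists 0%N.
case: (ex_minnP exN) => m /asboolW[k km] minm.
exists k => l kl; apply/esym/(leading_inj sxy) => //; first exact: anti.
have := leading_mono y (anti _ _ kl); rewrite subEproper => /predU1P[->//|].
move=> /proper_card; rewrite km ltnNge minm//.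
by apply/asboolP; exists l.
Qed.

End FrameTheory.

Lemma frame_simple_artinian (G : groupoid) (R : grRing G) :
  has_division_frame R -> gr_simple R /\ obj_artinian R.
Proof.
by move=> [e [eps [divE full]]]; split;
  [exact: (frame_simple divE)|exact: (frame_artinian divE)].
Qed.

(** * Graded isomorphisms *)

Section Isomorphisms.
Variables (G : groupoid) (R S : grRing G) (F : R -> S).
Hypothesis FB : {morph F : x y / x - y}.
Hypothesis FC : forall g x, rcomp R g x -> rcomp S g (F x).

Let dR := rcomp_direct R.
Let dS := rcomp_direct S.

Lemma hpart_morph P x : F (hpart dR P x) = hpart dS P (F x).
Proof.
apply: (@ring_ext _ _ _ (fun x => F (hpart dR P x)) (fun x => hpart dS P (F x)))
  => [y z|y z|g y Cy]; rewrite ?FB ?hpartB ?FB//.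
have [Pg|Pg] := pselect (P g).
  by rewrite (hpart_id dR Pg Cy) (hpart_id dS Pg (FC Cy)).
by rewrite (hpart_0 dR Pg Cy) (hpart_0 dS Pg (FC Cy)) (morphB0 FB).
Qed.

Lemma hpart1E g x : hpart dR [set g] x = hcomp dR x g.
Proof.
rewrite /hpart (@fsum1 _ _ _ g) => [|h hg]; by case: pselect => //=.
Qed.

(** Homogeneous components commute with [F], so a kernel element has all its
    components in the kernel. *)
Lemma gr_morph_inj :
  (forall g x, rcomp R g x -> F x = 0 -> x = 0) -> injective F.
Proof.
move=> F0 x y Fxy; apply/subr0_eq; set z := x - y.
have Fz : F z = 0 by rewrite FB Fxy subrr.
have [_ Cz ->] := hcompP dR z.
rewrite (@fsumE _ _ _ [::]) ?big_nil// => g; case; apply: F0 (Cz g) _.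
by rewrite -hpart1E hpart_morph Fz (morphB0 (hpartB dS _)).
Qed.

(** A degree-preserving bijection reflects degrees, because it commutes with
    taking homogeneous components. *)
Lemma gr_morph_inv (F' : S -> R) : cancel F F' -> cancel F' F ->
  forall g y, rcomp S g y -> rcomp R g (F' y).
Proof.
move=> FK F'K g y Cy; have := hpart_morph [set g] (F' y).
rewrite F'K (hpart_id dS (erefl : [set g] g) Cy) => /(congr1 F'); rewrite FK => <-.
by rewrite hpart1E; have [_ Cz _] := hcompP dR (F' y).
Qed.

Lemma gr_iso_intro :
  (forall g h x y, rcomp R g x -> rcomp R h y -> F (gmul x y) = gmul (F x) (F y)) ->
  (forall g x, rcomp R g x -> F x = 0 -> x = 0) ->
  (forall g a, rcomp S g a -> exists x, F x = a) -> gr_iso R S.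
Proof.
move=> FM F0 Fsurj; exists F.
have surj b : exists x, F x = b.
  have := direct_span dS b; move: b; apply: addspan_ind => [|b [g _ Cb]]; last exact: Fsurj Cb.
  split=> [|_ _ [x <-] [y <-]]; first by exists 0; exact: morphB0.
  by exists (x - y); exact: FB.
have [F' F'K] := choice surj.
split=> //.
- exists F' => // x; apply: (gr_morph_inj F0); exact: F'K.
- exact: morphB_add.
- move=> x y; move: x; apply: ring_ext => [x z|x z|g x Cx].
  + by rewrite gmulBl FB.
  + by rewrite FB gmulBl.
  move: y; apply: ring_ext => [y z|y z|h y Cy].
  + by rewrite gmulBr FB.
  + by rewrite FB gmulBr.
  exact: FM Cx Cy.
Qed.

End Isomorphisms.

Lemma gr_iso_sym (G : groupoid) (R S : grRing G) : gr_iso R S -> gr_iso S R.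
Proof.
move=> [F [[F' FK F'K] FD FM FC]].
have FB : {morph F : x y / x - y} by exact: add_morphB.
exists F'; split.
- by exists F.
- by move=> x y; rewrite -{1}(F'K x) -{1}(F'K y) -FD FK.
- by move=> x y; rewrite -{1}(F'K x) -{1}(F'K y) -FM FK.
- exact: gr_morph_inv FK F'K.
Qed.

(** The identities [1_f] are preserved because they are determined by the
    grading and the multiplication. *)
Lemma frame_iso (G : groupoid) (R S : grRing G) :
  gr_iso R S -> has_division_frame S -> has_division_frame R.
Proof.
move=> /gr_iso_sym[F [[F' FK F'K] FD FM FC]] [e [eps [[Ce e0 ee inv] full]]].
have FB : {morph F : x y / x - y} by exact: add_morphB.
have F0 := morphB0 FB.
have F'C := gr_morph_inv FB FC FK F'K.
have F_one f : F (gone S f) = gone R f.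
  have := gone_mul (F'C _ _ (gone_comp R f)); rewrite tgt_idn => /(congr1 F).
  rewrite FM F'K => <-; apply/esym.
  by have := gmul_one (FC _ _ (gone_comp S f)); rewrite src_idn.
exists e, (F eps); split.
  split=> [||| g a Ca ea ae a0]; first exact: FC.
  - by rewrite -F0 => /(can_inj FK).
  - by rewrite -FM ee.
  have [|||b [Cb eb be ab ba]] := inv g (F' a) (F'C _ _ Ca).
  - by apply: (can_inj FK); rewrite FM F'K.
  - by apply: (can_inj FK); rewrite FM F'K.
  - by move=> E; apply: a0; rewrite -(F'K a) E.
  exists (F b); rewrite -(F'K a) -!FM ab ba eb be; split=> //; exact: FC.
move=> f; have [n [g [x [y [[gef Cx Cy yx] sxy]]]]] := full f.
exists n, g, (F \o x), (F \o y); split; last first.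
  by rewrite -F_one -sxy (morphB_sum _ _ FB); apply: eq_bigr => i _; rewrite FM.
split=> // [i|i|i j] /=.
- by split; [exact: FC _ _ (Cx i).1|rewrite -FM (Cx i).2].
- by split; [exact: FC _ _ (Cy i).1|rewrite -FM (Cy i).2].
- by rewrite -FM yx; case: eqP.
Qed.

Lemma span_image (G : groupoid) (R : grRing G) (A : zmodType) (C : G -> set A)
    (F : R -> A) :
  {morph F : x y / x - y} -> (forall g x, rcomp R g x -> C g (F x)) ->
  forall x, addspan (\bigcup_g C g) (F x).
Proof.
move=> FB FC x; have := direct_span (rcomp_direct R) x; move: x.
have [S0 SB] := addspan_subgroup (\bigcup_g C g).
apply: addspan_ind => [|x [g _ Cx]]; last by apply: addspan_sub; exists g => //; exact: FC.
split=> [|x y Sx Sy] /=; first by rewrite (morphB0 FB).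
by rewrite FB; exact: SB.
Qed.

Section SpanIso.
Variables (G : groupoid) (A : zmodType) (C : G -> set A).
Variables (m : A -> A -> A) (u : obj G -> A) (ax : gr_laws C m u).

Definition span_hom g a (Ca : C g a) : gr_span ax :=
  SpanT (introT (span_predP _ _)
    (addspan_sub (ex_intro2 _ _ g I Ca : (\bigcup_g C g) a))).

Lemma gr_iso_span (R : grRing G) (F : R -> A) :
  {morph F : x y / x - y} -> (forall g x, rcomp R g x -> C g (F x)) ->
  (forall g h x y, rcomp R g x -> rcomp R h y -> F (gmul x y) = m (F x) (F y)) ->
  (forall g x, rcomp R g x -> F x = 0 -> x = 0) ->
  (forall g a, C g a -> exists x, F x = a) -> gr_iso R (gr_span ax).
Proof.
move=> FB FC FM F0 Fsurj.
pose F1 x : gr_span ax := SpanT (introT (span_predP _ _) (span_image FB FC x)).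
apply: (@gr_iso_intro _ _ _ F1) => [x y|g x Cx|g h x y Cx Cy|g x Cx E|g a Ca].
- by apply: val_inj; exact: FB.
- by apply: (FC).
- by apply: val_inj; exact: (FM _ _ _ _ Cx Cy).
- by apply: F0 Cx _; exact: (congr1 val E).
- by have [x Fx] := Fsurj g _ Ca; exists x; exact: val_inj.
Qed.

End SpanIso.

(** * Matrix units over gr-prime division rings *)

(** A nonzero graded ideal of a graded division ring supported on the loops at
    [e] contains an invertible element, hence the identity. *)
Lemma corner_division_prime (G : groupoid) (D : grRing G) (e : obj G) :
  gr_division D -> supp D `<=` corner e e -> gr_prime D.
Proof.
move=> [_ inv] De I J gI gJ I0 J0.
have one_mem (K : set D) : gr_ideal K -> K <> [set 0] ->
    K (gone D e) /\ gone D e <> 0.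
  move=> [sK lK rK gK] K0.
  have [w Kw w0] : exists2 w, K w & w <> 0.
    apply: contrapT => n; apply: K0; apply/seteqP; split=> [w Kw|_ ->].
      by apply: contrapT => w0; apply: n; exists w.
    exact: sK.1.
  have [g [a [Ka Ca a0]]] := graded_homogeneous gK Kw w0.
  have [|ge _] := De g; first by move=> D0; apply: a0; move: Ca; rewrite D0.
  have [b [_ ab _]] := inv g a Ca a0.
  rewrite -ge; split; last exact: gone_neq0 Ca a0.
  by rewrite -ab; exact: rK.
have [I1 e0] := one_mem I gI I0; have [J1 _] := one_mem J gJ J0.
move=> E; apply: e0; have : ideal_prod I J (gone D e); last by rewrite E.
by apply: addspan_sub; exists (gone D e) => //; exists (gone D e) => //; exact: gone_gone.
Qed.

Section Units.
Variables (G : groupoid) (A : zmodType) (C : G -> set A).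
Variables (m : A -> A -> A) (u : obj G -> A) (ax : gr_laws C m u).
Variables (D : grRing G) (J : Type) (c : J -> G) (E : J -> J -> D -> A).

(** Matrix units [E i j a], of degree [c i k (c j)^-1] for [a] of degree [k].
    The relations are only required for homogeneous coefficients whose degree
    runs from [src (c j)] to [src (c i)], as other coefficients do not give
    elements of the ring.  [unit_surj] says that the corner at [j] consists of
    units, and [unit_one] that the diagonal units over [f] add up to [1_f]. *)
Record matrix_units : Prop := MatrixUnits {
  unit_0 : forall i j, E i j 0 = 0;
  unit_comp : forall i j k a, tgt k = src (c i) -> src k = src (c j) ->
    rcomp D k a -> C (gcomp (gcomp (c i) k) (ginv (c j))) (E i j a);
  unit_mul : forall i j l k k' a b, tgt k = src (c i) -> src k = src (c j) ->
    tgt k' = src (c j) -> src k' = src (c l) -> rcomp D k a -> rcomp D k' b ->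
    m (E i j a) (E j l b) = E i l (gmul a b);
  unit_mul0 : forall i j j' l k k' a b, j <> j' -> tgt k = src (c i) ->
    src k = src (c j) -> tgt k' = src (c j') -> src k' = src (c l) ->
    rcomp D k a -> rcomp D k' b -> m (E i j a) (E j' l b) = 0;
  unit_neq0 : forall j, E j j (gone D (src (c j))) <> 0;
  unit_surj : forall j g a, tgt g = tgt (c j) -> src g = tgt (c j) -> C g a ->
    m (E j j (gone D (src (c j)))) a = a ->
    m a (E j j (gone D (src (c j)))) = a ->
    exists d, rcomp D (gcomp (gcomp (ginv (c j)) g) (c j)) d /\ a = E j j d;
  unit_one : forall f, exists n (s : 'I_n -> J),
    [/\ injective s, forall i, tgt (c (s i)) = f &
        \sum_(i < n) E (s i) (s i) (gone D (src (c (s i)))) = u f] }.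

Hypotheses (units : matrix_units) (divD : gr_division D).
Hypothesis (pD : elementwise_prime D).

(** Primeness links any two vertices at which [D] is nonzero by an invertible
    element. *)
Lemma exists_link e f : gone D e <> 0 -> gone D f <> 0 -> exists k a b,
  [/\ src k = e /\ tgt k = f, rcomp D k a, rcomp D (ginv k) b,
      gmul a b = gone D f & gmul b a = gone D e].
Proof.
move=> e0 f0; have [k [a [Ca fae]]] := pD (gone_comp D f) (gone_comp D e) f0 e0.
have kf : tgt k = f.
  by apply: contrapT => kf; apply: fae; rewrite (gone_mul0 Ca kf) gmul0l.
have ke : src k = e.
  apply: contrapT => ke; apply: fae.
  by rewrite -gmulA (gmul_one0 Ca ke) gmul0r.
have a0 : a <> 0 by move=> a0; apply: fae; rewrite a0 gmul0r gmul0l.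
have [b [Cb ab ba]] := divD.2 k a Ca a0.
by exists k, a, b; rewrite -ke -kf.
Qed.

(** A fixed [j0] serves as base point: with [a j], [b j] inverse to each other
    in [D] and linking [src (c j)] to [src (c j0)], the families
    [E j j0 (a j)] and [E j0 j (b j)] are dual over the corner at [j0]. *)
Lemma units_frame (j0 : J) : has_division_frame (gr_span ax).
Proof.
have [E0 EC EM EM0 En Es E1] := units.
pose D1 j := gone D (src (c j)).
have D10 j : D1 j <> 0 by move=> D0; apply: (En j); rewrite -/(D1 j) D0 E0.
have CD1 j : rcomp D (idn (src (c j))) (D1 j) by exact: gone_comp.
have diag j : gcomp (gcomp (c j) (idn (src (c j)))) (ginv (c j)) = idn (tgt (c j)).
  by rewrite gcomp_idr gcompV.
have CE1 j : C (idn (tgt (c j))) (E j j (D1 j)).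
  by rewrite -diag; apply: EC => //; rewrite ?tgt_idn ?src_idn.
pose e := tgt (c j0).
pose eps := span_hom ax (CE1 j0).
have /choice[t tP] j : exists t : G * (D * D), [/\ src t.1 = src (c j0) /\
    tgt t.1 = src (c j), rcomp D t.1 t.2.1, rcomp D (ginv t.1) t.2.2,
    gmul t.2.1 t.2.2 = D1 j & gmul t.2.2 t.2.1 = D1 j0].
  have [k [a [b H]]] := exists_link (D10 j0) (D10 j).
  by exists (k, (a, b)).
have CX j : C (gcomp (gcomp (c j) (t j).1) (ginv (c j0))) (E j j0 (t j).2.1).
  by have [[h1 h2] ? ? _ _] := tP j; exact: EC.
have CY j : C (ginv (gcomp (gcomp (c j) (t j).1) (ginv (c j0)))) (E j0 j (t j).2.2).
  have [[h1 h2] ? Ct _ _] := tP j.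
  rewrite ginv_comp ?src_comp ?tgt_inv// ginvK ginv_comp// gcompA ?tgt_inv ?src_inv//.
  by apply: EC; rewrite ?tgt_inv ?src_inv.
have ul j j' k a : rcomp D k a -> tgt k = src (c j) -> src k = src (c j') ->
    m (E j j (D1 j)) (E j j' a) = E j j' a.
  move=> Ca tk sk; rewrite (EM _ _ _ (idn (src (c j))) k) ?tgt_idn ?src_idn//.
  by rewrite /D1 -tk (gone_mul Ca).
have ur j j' k a : rcomp D k a -> tgt k = src (c j) -> src k = src (c j') ->
    m (E j j' a) (E j' j' (D1 j')) = E j j' a.
  move=> Ca tk sk; rewrite (EM _ _ _ k (idn (src (c j')))) ?tgt_idn ?src_idn//.
  by rewrite /D1 -sk (gmul_one Ca).
exists e, eps; split.
  split; first exact: CE1.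
  - by move=> /(congr1 val); exact: En.
  - by apply: val_inj; apply: (ul j0 j0) (CD1 j0) _ _; rewrite ?tgt_idn ?src_idn.
  move=> g a Ca ea ae a0.
  have ge : tgt g = e.
    apply: contrapT => ge; apply: a0; rewrite -ea.
    apply: (@rcompM0 _ (gr_span ax) _ _ _ _ _ (CE1 j0 : rcomp (gr_span ax) _ eps) Ca).
    by rewrite src_idn => eg; apply: ge.
  have eg : src g = e.
    apply: contrapT => eg; apply: a0; rewrite -ae.
    apply: (@rcompM0 _ (gr_span ax) _ _ _ _ _ Ca (CE1 j0 : rcomp (gr_span ax) _ eps)).
    by rewrite tgt_idn.
  have [d [Cd aE]] := Es j0 g (val a) ge eg Ca (congr1 val ea) (congr1 val ae).
  have d0 : d <> 0 by move=> d0; apply: a0; apply: val_inj; rewrite aE d0 E0.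
  have e1 : src (ginv (c j0)) = tgt g by rewrite src_inv.
  have e2 : src (gcomp (ginv (c j0)) g) = tgt (c j0) by rewrite src_comp.
  have [b [Cb db bd]] := divD.2 _ d Cd d0.
  have tk : tgt (gcomp (gcomp (ginv (c j0)) g) (c j0)) = src (c j0).
    by rewrite tgt_comp// tgt_comp// tgt_inv.
  have sk : src (gcomp (gcomp (ginv (c j0)) g) (c j0)) = src (c j0).
    by rewrite src_comp.
  have CEb : C (ginv g) (E j0 j0 b).
    have := EC j0 j0 _ b _ _ Cb; rewrite src_inv tgt_inv tk sk => /(_ erefl erefl).
    congr (C _ _).
    rewrite ginv_comp// ginv_comp// ginvK gcompKl; last by rewrite tgt_comp ?tgt_inv ?src_inv.
    by rewrite gcompK// src_inv.
  exists (span_hom ax CEb); split=> //; apply: val_inj => /=.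
  - by apply: (ul j0 j0) Cb _ _; rewrite ?tgt_inv ?src_inv ?sk.
  - by apply: (ur j0 j0) Cb _ _; rewrite ?tgt_inv ?src_inv ?tk.
  - rewrite aE (EM _ _ _ _ _ _ _ tk sk _ _ Cd Cb) ?tgt_inv ?src_inv ?tk ?sk//.
    by rewrite db tk.
  - rewrite aE (EM _ _ _ _ _ _ _ _ _ tk sk Cb Cd) ?tgt_inv ?src_inv ?tk ?sk//.
    by rewrite bd sk.
move=> f; have [n [s [sI sf sE]]] := E1 f.
exists n, (fun i => gcomp (gcomp (c (s i)) (t (s i)).1) (ginv (c j0))).
exists (fun i => span_hom ax (CX (s i))), (fun i => span_hom ax (CY (s i))).
split; last first.
  apply: val_inj; rewrite raddf_sum -[RHS]sE; apply: eq_bigr => i _ /=.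
  have [[h1 h2] Ca Cb ab _] := tP (s i).
  by rewrite (EM _ _ _ _ _ _ _ _ _ _ _ Ca Cb) ?tgt_inv ?src_inv// ab.
split=> [i|i|i|i j].
- have [[h1 h2] _ _ _ _] := tP (s i).
  rewrite src_comp ?src_comp ?tgt_inv// src_inv; split=> //.
  by rewrite tgt_comp ?src_comp ?tgt_inv// tgt_comp// sf.
- have [[h1 h2] Ca _ _ _] := tP (s i).
  split; first exact: CX.
  by apply: val_inj; apply: (ur _ _ _ _ Ca).
- have [[h1 h2] _ Cb _ _] := tP (s i).
  split; first exact: CY.
  by apply: val_inj; apply: (ul _ _ _ _ Cb); rewrite ?tgt_inv ?src_inv.
have [[h1 h2] _ Cb _ ba] := tP (s i); have [[h1' h2'] Ca _ _ _] := tP (s j).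
case: eqP => ij.
  rewrite -ij in Ca h1' h2' *; apply: val_inj => /=.
  by rewrite (EM _ _ _ _ _ _ _ _ _ _ _ Cb Ca) ?tgt_inv ?src_inv// ba.
apply: val_inj => /=.
by rewrite (EM0 _ _ _ _ _ _ _ _ _ _ _ _ _ Cb Ca) ?tgt_inv ?src_inv// => /sI.
Qed.

End Units.

(** * Frames of matrix rings *)

(** [{classic T}] carries the equality test of excluded middle, which is not
    convertible to the one of an [eqType]. *)
Lemma mem_classic (T : eqType) (s : seq T) (t : T) :
  ((t : {classic T}) \in (s : seq {classic T})) = (t \in s).
Proof.
elim: s => // t' s; rewrite !in_cons => ->; congr (_ || _).
by apply/idP/idP => /eqP ->.
Qed.

Lemma fsum_ord (A : zmodType) n (a : 'I_n -> A) : fsum a = \sum_(i < n) a i.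
Proof.
rewrite (@fsumE _ _ a (enum 'I_n : seq {classic 'I_n})).
- by rewrite big_enum.
- have : uniq (enum 'I_n) by exact: enum_uniq.
  elim: (enum 'I_n) => //= i s IH /andP[si us].
  by rewrite IH// andbT mem_classic.
- by move=> i _; rewrite mem_classic mem_enum.
Qed.

Lemma finite_support_ord (A : zmodType) n (a : 'I_n -> A) : Defs.finite_support a.
Proof. exact: finite_finset. Qed.

Section MatrixFrame.
Variables (G : groupoid) (D : grRing G) (I : Type) (Sg : I -> set G).
Hypothesis mSg : matricial D Sg.

(** The vertices of the matrix ring: the [i]-th diagonal position splits into
    one homogeneous idempotent for each element of [Sg i]. *)
Definition vertex := {p : I * G | Sg p.1 p.2}.

Definition vertex_deg (p : vertex) : G := ginv (sval p).2.

Definition mx_unit (p q : vertex) (a : D) : I -> I -> D :=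
  fun i j => if pselect (i = (sval p).1 /\ j = (sval q).1) then a else 0.

Lemma mx_unitE p q a i j : i = (sval p).1 -> j = (sval q).1 ->
  mx_unit p q a i j = a.
Proof. by move=> ip jq; rewrite /mx_unit; case: pselect => // -[]. Qed.

Lemma mx_unit_off p q a i j : ~ (i = (sval p).1 /\ j = (sval q).1) ->
  mx_unit p q a i j = 0.
Proof. by rewrite /mx_unit; case: pselect. Qed.

Lemma vertex_inj (p q : vertex) : (sval p).1 = (sval q).1 ->
  tgt (sval p).2 = tgt (sval q).2 -> p = q.
Proof.
have [_ _ utgt _ _] := mSg.
case: p q => -[i s] /= Ss [[j t] /= St] ij; subst j => st.
have st' : s = t by exact: (utgt i).
by subst t; congr (exist _ _ _); exact: Prop_irrelevance.
Qed.

Lemma mx_unit_mul p q q' r a b : (sval q).1 = (sval q').1 ->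
  mx_mul (mx_unit p q a) (mx_unit q' r b) = mx_unit p r (gmul a b).
Proof.
move=> qq'; apply/funext => i; apply/funext => l.
rewrite /mx_mul (@fsum1 _ _ _ (sval q).1) => [|j jq]; last first.
  by rewrite mx_unit_off ?gmul0l// => -[].
have [ip|ip] := pselect (i = (sval p).1); last first.
  by rewrite [RHS]mx_unit_off ?[X in gmul X _]mx_unit_off ?gmul0l//; case.
have [lr|lr] := pselect (l = (sval r).1); last first.
  by rewrite [X in gmul _ X]mx_unit_off ?[RHS]mx_unit_off ?gmul0r//; case.
by rewrite !mx_unitE.
Qed.

Lemma mx_unit_mul0 p q q' r a b : (sval q).1 <> (sval q').1 ->
  mx_mul (mx_unit p q a) (mx_unit q' r b) = 0.
Proof.
move=> qq'; apply/funext => i; apply/funext => l.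
rewrite /mx_mul (@fsum1 _ _ _ (sval q).1) => [|j jq].
  by rewrite [X in gmul _ X]mx_unit_off ?gmul0r//; case.
by rewrite mx_unit_off ?gmul0l// => -[].
Qed.

(** Two vertices [q <> q'] over the same diagonal position give orthogonal
    units although the matrix product does not separate them: the elements of
    [Sg i] have distinct targets, so the product of coefficients vanishes. *)
Lemma mx_matrix_units :
  matrix_units (mx_comp Sg) (@mx_mul _ D I) (mx_one D Sg) vertex_deg mx_unit.
Proof.
have [_ usrc _ Dtgt fin] := mSg.
split.
- move=> p q; apply/funext => i; apply/funext => j.
  by rewrite /mx_unit; case: pselect.
- move=> p q k a; rewrite /vertex_deg !src_inv ginvK => kp kq Ca; split.
    apply: (sub_finite_set _ (finite_set1 ((sval p).1, (sval q).1))) => -[i j] /=.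
    rewrite /mx_unit; case: pselect => //= -[-> ->]//.
  move=> i j; rewrite /mx_unit; case: pselect => [[ip jq]|_] /=; [rewrite ip jq|by left].
  have e1 : src (ginv (sval p).2) = tgt k by rewrite src_inv.
  have e2 : src (gcomp (ginv (sval p).2) k) = tgt (sval q).2 by rewrite src_comp.
  right; exists (sval p).2, (sval q).2; split.
  + exact: svalP p.
  + exact: svalP q.
  + by rewrite tgt_comp// tgt_comp// tgt_inv.
  + by rewrite src_comp.
  + apply: rcomp_eq Ca; rewrite -gcompA ?tgt_comp ?tgt_inv ?src_comp//.
    by rewrite gcompK// gcompKl.
- by move=> p q r k k' a b _ _ _ _ _ _; exact: mx_unit_mul.
- move=> p q q' r k k' a b qq' _; rewrite /vertex_deg !src_inv => kq kq' _ Ca Cb.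
  have [E|E] := pselect ((sval q).1 = (sval q').1); last exact: mx_unit_mul0.
  rewrite mx_unit_mul// (rcompM0 _ Ca Cb).
    by apply/funext => i; apply/funext => j; rewrite /mx_unit; case: pselect.
  by rewrite kq kq' => t; apply: qq'; exact: vertex_inj.
- move=> p; rewrite /vertex_deg src_inv => /(congr1 (fun f => f (sval p).1 (sval p).1)).
  by rewrite mx_unitE//; exact: Dtgt (svalP p).
- move=> p g a; rewrite /vertex_deg tgt_inv src_inv ginvK => tg sg [_ Ca] ea ae.
  exists (a (sval p).1 (sval p).1); split.
    have [->|[s [t [Ss St ss st Cx]]]] := Ca (sval p).1 (sval p).1; first exact: rcomp0.
    move: Cx; rewrite (usrc _ _ _ Ss (svalP p)) ?ss//.
    by rewrite (usrc _ _ _ St (svalP p)) ?st.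
  apply/funext => i; apply/funext => j.
  have [ip|ip] := pselect (i = (sval p).1); last first.
    rewrite mx_unit_off; last by case.
    rewrite -ea /mx_mul (@fsumE _ _ _ [::]) ?big_nil// => k; case.
    by rewrite mx_unit_off ?gmul0l//; case.
  have [jp|jp] := pselect (j = (sval p).1); last first.
    rewrite mx_unit_off; last by case.
    rewrite -ae /mx_mul (@fsumE _ _ _ [::]) ?big_nil// => k; case.
    by rewrite mx_unit_off ?gmul0r//; case.
  by rewrite mx_unitE// ip jp.
- move=> f; have [s0 [us0 s0P]] := finite_set_seq (fin f).
  pose P (i : {classic I}) := `[< exists2 t, Sg i t & src t = f >].
  pose s := [seq i <- s0 | P i].
  have us : uniq s by rewrite filter_uniq.
  have /choice[q qP] (k : 'I_(size s)) : exists p : vertex,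
      (sval p).1 = tnth (in_tuple s) k /\ src (sval p).2 = f.
    have : tnth (in_tuple s) k \in s by exact: mem_tnth.
    rewrite mem_filter => /andP[/asboolW[t St tf] _].
    by exists (exist (fun p : I * G => Sg p.1 p.2) (tnth (in_tuple s) k, t) St).
  have tI : injective (tnth (in_tuple s)) by apply/tuple_uniqP.
  exists (size s), q; split.
  + by move=> k l kl; apply: tI; rewrite -(qP k).1 -(qP l).1 kl.
  + by move=> k; rewrite /vertex_deg tgt_inv (qP k).2.
  apply/funext => i; apply/funext => j; rewrite !fct_sumE.
  have [ij|ij] := pselect (i = j); last first.
    rewrite mx_one_offdiag// big1// => k _; apply: mx_unit_off => -[ik jk].
    by apply: ij; rewrite ik jk.
  subst j; have [[t St tf]|n] := pselect (exists2 t, Sg i t & src t = f).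
    have : (i : {classic I}) \in s.
      by rewrite mem_filter; apply/andP; split; [apply/asboolP; exists t|apply: s0P; exists t].
    move=> /(tnthP (in_tuple s))[k ik]; rewrite (mx_one_diag mSg St tf) (bigD1 k)//=.
    rewrite big1 => [|l lk].
      rewrite addr0 mx_unitE /vertex_deg ?src_inv ?(qP k).1//.
      congr (gone D (tgt _)); apply: (usrc i) => //; last by rewrite (qP k).2.
      by have := svalP (q k); rewrite (qP k).1 -ik.
    apply: mx_unit_off => -[E _]; move/eqP: lk; apply; apply: tI.
    by rewrite -(qP l).1 -E ik.
  rewrite big1 => [|k _].
    rewrite /mx_one; case: pselect => // h; have [_ [t [St tf]]] := h.
    by case: n; exists t.
  apply: mx_unit_off => -[E _]; apply: n; exists (sval (q k)).2; last exact: (qP k).2.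
  by rewrite E; exact: svalP (q k).
Qed.

End MatrixFrame.

Lemma mx_ring_frame (G : groupoid) (D : grRing G) (I : Type) (Sg : I -> set G)
    (mSg : matricial D Sg) :
  gr_division D -> gr_prime D -> inhabited I -> has_division_frame (mx_ring mSg).
Proof.
move=> divD pD [i]; have [/(_ i)[s Ss] _ _ _ _] := mSg.
apply: (units_frame _ (mx_matrix_units mSg) divD (gr_prime_elementwise pD)).
exact: (exist _ (i, s) Ss).
Qed.

(** * Frames of endomorphism rings *)

Section Modules.
Variables (G : groupoid) (D : grRing G) (V : grMod D).
Implicit Types (v w : V) (a b : D) (g h : G).

Let dV := mcomp_direct V.
Let dD := rcomp_direct D.

Lemma gact0l a : gact (0 : V) a = 0.
Proof. exact: morphB0 (gactBl a). Qed.

Lemma gact0r v : gact v 0 = 0.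
Proof. exact: morphB0 (gactBr v). Qed.

Lemma gact_suml (I : Type) (r : seq I) (F : I -> V) a :
  gact (\sum_(i <- r) F i) a = \sum_(i <- r) gact (F i) a.
Proof. exact: (morphB_sum r F (gactBl a)). Qed.

(** Since [V D = V], it is enough to see [1] act trivially on products. *)
Lemma gact_one h v : mcomp V h v -> gact v (gone D (src h)) = v.
Proof.
move=> Cv; have : addspan [set gact w a | w in [set: V] & a in [set: D]] v by rewrite gact_full.
suff : addspan [set gact w a | w in [set: V] & a in [set: D]] `<=`
    [set v | gact (hpart dV [set h] v) (gone D (src h)) = hpart dV [set h] v].
  by move=> S /S /=; rewrite (hpart_id dV (erefl : [set h] h) Cv).
have pB := hpartB dV [set h]; have p0 := morphB0 pB.
apply: addspan_ind => [|_ [w _ [a _ <-]]] /=.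
  split=> [|x y Ex Ey] /=; first by rewrite p0 gact0l.
  by rewrite pB gactBl Ex Ey.
move: a; apply: ring_ext => [a b|a b|k a Ca].
- by rewrite gactBr pB gactBl.
- by rewrite gactBr pB.
move: w; apply: (direct_ext dV) => [w x|w x|g w Cw].
- by rewrite !(gactBl, pB).
- by rewrite gactBl pB.
have [gk|gk] := pselect (src g = tgt k); last by rewrite (mcompM0 gk Cw Ca) p0 gact0l.
have Cwa := mcompM gk Cw Ca.
have [gkh|gkh] := pselect (gcomp g k = h).
  rewrite (hpart_id dV (gkh : [set h] _) Cwa) gactA -gkh src_comp//.
  by rewrite (gmul_one Ca).
by rewrite (hpart_0 dV (gkh : ~ [set h] _) Cwa) gact0l.
Qed.

(** Homogeneous bases of all the [V(f)] at once, together with their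
    coordinate functionals. *)
Record dual_basis (J : Type) (c : J -> G) (x : J -> V) (K : J -> V -> D) : Prop :=
  DualBasis {
  basis_comp : forall j, mcomp V (c j) (x j);
  basis_neq0 : forall j, x j <> 0;
  coordB : forall j, {morph K j : v w / v - w};
  coordZ : forall j v a, K j (gact v a) = gmul (K j v) a;
  coord_comp : forall j h v, mcomp V h v -> tgt h = tgt (c j) ->
    rcomp D (gcomp (ginv (c j)) h) (K j v);
  coord_off : forall j h v, mcomp V h v -> tgt h <> tgt (c j) -> K j v = 0;
  coord_basis : forall j, K j (x j) = gone D (src (c j));
  coord_basis0 : forall i j, i <> j -> K i (x j) = 0;
  basis_span : forall f, exists n (s : 'I_n -> J),
    [/\ injective s, forall i, tgt (c (s i)) = f &
        forall v, end_one f v = \sum_(i < n) gact (x (s i)) (K (s i) v)] }.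

(** The endomorphism [x i a (x j)^*], with [(x j)^* = K j]. *)
Definition rank_one J (x : J -> V) (K : J -> V -> D) (i j : J) (a : D) : V -> V :=
  fun v => gact (x i) (gmul a (K j v)).

Section EndUnits.
Variables (J : Type) (c : J -> G) (x : J -> V) (K : J -> V -> D).
Hypothesis bV : dual_basis c x K.

Lemma end_matrix_units :
  matrix_units (@end_comp _ D V) (@end_mul _ D V) (@end_one _ D V) c (rank_one x K).
Proof.
have [Cx x0 KB KZ KC Koff Kx Kx0 spanV] := bV.
have K0 j : K j 0 = 0 := morphB0 (KB j).
have one_coord j v : gmul (gone D (src (c j))) (K j v) = K j v.
  move: v; apply: (direct_ext dV) => [v w|v w|h v Cv]; rewrite ?KB ?gmulBr//.
  have [hj|hj] := pselect (tgt h = tgt (c j)); last by rewrite (Koff _ _ _ Cv hj) gmul0r.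
  have := gone_mul (KC _ _ _ Cv hj).
  by rewrite tgt_comp ?src_inv ?hj// tgt_inv.
split; rewrite /rank_one.
- by move=> i j; apply/funext => v; rewrite gmul0l gact0r.
- move=> i j k a ki kj Ca; split=> [v w|v b|s v|s v].
  + by rewrite (morphB_add (KB j)) gmulDr gactDr.
  + by rewrite KZ gmulA gactA.
  + have e1 : src (c i) = tgt k by [].
    have e2 : src (gcomp (c i) k) = tgt (ginv (c j)) by rewrite src_comp// tgt_inv.
    rewrite src_comp// src_inv => js Cv.
    have e3 : src (ginv (c j)) = tgt s by rewrite src_inv.
    have e4 : src k = tgt (gcomp (ginv (c j)) s) by rewrite tgt_comp// tgt_inv.
    have := mcompM _ (Cx i) (rcompM e4 Ca (KC _ _ _ Cv (esym js))).
    rewrite tgt_comp// => /(_ e1); congr (mcomp V _ _).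
    by rewrite gcompA// gcompA.
  + rewrite src_comp ?src_comp ?tgt_inv// src_inv => js Cv.
    by rewrite (Koff _ _ _ Cv) ?gmul0r ?gact0r// => E; apply: js.
- move=> i j l k k' a b ki kj kj' kl Ca Cb; apply/funext => v; rewrite /end_mul /=.
  by rewrite KZ Kx !gmulA -kj (gmul_one Ca).
- move=> i j j' l k k' a b jj' _ _ _ _ _ _; apply/funext => v; rewrite /end_mul /=.
  by rewrite KZ Kx0// gmul0l gmul0r gact0r.
- move=> j /(congr1 (fun f => f (x j))); rewrite Kx gone_gone (gact_one (Cx j)).
  exact: x0.
- move=> j g a tg sg [aD aZ aC aO] ea ae.
  exists (K j (a (x j))); split.
    have Cax := aC _ _ sg (Cx j).
    have := KC j _ _ Cax; rewrite tgt_comp// => /(_ tg).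
    by rewrite gcompA// src_inv.
  apply/funext => v; rewrite -{1}ea -{1}ae /end_mul /= one_coord aZ.
  by rewrite one_coord KZ.
- move=> f; have [n [s [sI sf sP]]] := spanV f; exists n, s; split=> //.
  apply/funext => v; rewrite fct_sumE sP; apply: eq_bigr => i _.
  by rewrite one_coord.
Qed.

End EndUnits.

Lemma fiber_hpart f v : fiber f v -> end_one f v = v.
Proof.
move: v; apply: addspan_ind => [|v [g gf Cv]].
  by apply: subgroup_equalizer; [exact: hpartB|].
exact: hpart_id gf Cv.
Qed.

Lemma hpart_fiber f v : fiber f (end_one f v).
Proof.
have [S0 SB] := addspan_subgroup (\bigcup_(g in [set g | tgt g = f]) mcomp V g).
have := direct_span dV v; move: v; apply: addspan_ind => [|v [g _ Cv]].
  split=> [|v w Sv Sw]; rewrite /= /end_one; first by rewrite (morphB0 (hpartB dV _)).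
  by rewrite hpartB; exact: SB.
rewrite /= /end_one; have [gf|gf] := pselect (tgt g = f); last first.
  by rewrite (hpart_0 dV gf Cv).
by rewrite (hpart_id dV gf Cv); apply: addspan_sub; exists g.
Qed.

Lemma fiber_submodule f : submodule (fiber f : set V).
Proof.
have sF : subgroup (fiber f : set V) by exact: addspan_subgroup.
split=> // v d; move: v; apply: addspan_ind => [|v [h /= hf Cv]].
  split=> [|v w Fv Fw] /=; first by rewrite gact0l; exact: sF.1.
  by rewrite gactBl; exact: sF.2.
have := direct_span dD d; move: d; apply: addspan_ind => [|d [k _ Cd]].
  split=> [|a b Fa Fb] /=; first by rewrite gact0r; exact: sF.1.
  by rewrite gactBr; exact: sF.2.
have [hk|hk] := pselect (src h = tgt k); last first.
  by rewrite /= (mcompM0 hk Cv Cd); exact: sF.1.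
apply: addspan_sub; exists (gcomp h k) => /=; first by rewrite tgt_comp.
exact: mcompM hk Cv Cd.
Qed.

Section FiberCoordinates.
Variables (f : obj G) (n : nat) (x : 'I_n -> V) (g : 'I_n -> G).
Hypothesis bx : pseudo_basis (fiber f) x g.

Definition coordinates v (a : 'I_n -> D) : Prop :=
  (forall i, gmul (gone D (src (g i))) (a i) = a i) /\
  v = \sum_(i < n) gact (x i) (a i).

Lemma basis_tgt i : tgt (g i) = f.
Proof.
have [xP spanx _] := bx; have [x0 Cx] := xP i.
have : fiber f (x i) by rewrite spanx => S [_]; apply; exists i.
move=> /fiber_hpart; rewrite /end_one; have [//|gf] := pselect (tgt (g i) = f).
by rewrite (hpart_0 dV gf Cx) => /esym.
Qed.

Lemma coordinatesB v w (a b : 'I_n -> D) : coordinates v a -> coordinates w b ->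
  coordinates (v - w) (fun i => a i - b i).
Proof.
move=> [a1 ->] [b1 ->]; split=> [i|]; first by rewrite gmulBr a1 b1.
by rewrite -sumrB; apply: eq_bigr => i _; rewrite gactBr.
Qed.

Lemma coordinatesZ v (a : 'I_n -> D) d : coordinates v a ->
  coordinates (gact v d) (fun i => gmul (a i) d).
Proof.
move=> [a1 ->]; split=> [i|]; first by rewrite gmulA a1.
by rewrite gact_suml; apply: eq_bigr => i _; rewrite gactA.
Qed.

Lemma coordinates_basis i :
  coordinates (x i) (fun j => if j == i then gone D (src (g i)) else 0).
Proof.
split=> [j|]; first by case: eqP => [->|]; rewrite ?gone_gone ?gmul0r.
rewrite (bigD1 i)//= eqxx big1 => [|j /negPf ->]; last exact: gact0r.
by rewrite addr0 gact_one//; have [xP _ _] := bx; exact: (xP i).2.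
Qed.

Lemma coordinates_uniq v (a b : 'I_n -> D) : coordinates v a -> coordinates v b -> a = b.
Proof.
move=> va vb; have [d1] := coordinatesB va vb; rewrite subrr => d0.
have [_ _ ind] := bx; apply/funext => i; apply/subr0_eq.
apply: (ind (fun i => a i - b i)) => [|j|]; first exact: finite_support_ord.
  by exists (a j - b j) => //; exact: d1.
by rewrite fsum_ord.
Qed.

Lemma coordinates_exist v : fiber f v -> exists a : 'I_n -> D, coordinates v a.
Proof.
have [xP -> _] := bx => /(_ [set v | exists a : 'I_n -> D, coordinates v a]); apply.
split; last by move=> _ [i _ <-]; eexists; exact: coordinates_basis.
split=> [|v' d [a va]]; last by eexists; exact: coordinatesZ va.
split=> [|v1 v2 [a va] [b vb]]; last by eexists; exact: coordinatesB va vb.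
exists (fun=> 0); split=> [i|]; first exact: gmul0r.
by rewrite big1// => i _; exact: gact0r.
Qed.

Lemma gact_hpart i h a : tgt h = f ->
  gact (x i) (hpart dD [set gcomp (ginv (g i)) h] a) =
  hpart dV [set h] (gact (x i) a).
Proof.
move=> hf; have [xP _ _] := bx; have [_ Cx] := xP i.
have gh : tgt (g i) = tgt h by rewrite hf basis_tgt.
move: a; apply: ring_ext => [a b|a b|k a Ca].
- by rewrite hpartB gactBr.
- by rewrite gactBr hpartB.
have [gk|gk] := pselect (src (g i) = tgt k); last first.
  rewrite (mcompM0 gk Cx Ca) (morphB0 (hpartB dV _)) (hpart_0 dD _ Ca) ?gact0r//=.
  by move=> kE; apply: gk; rewrite kE tgt_comp ?tgt_inv ?src_inv.
have Cxa := mcompM gk Cx Ca.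
have [kE|kE] := pselect (k = gcomp (ginv (g i)) h).
  rewrite (hpart_id dD (kE : [set _] k) Ca) (hpart_id dV _ Cxa)//=.
  by rewrite kE gcompKl.
rewrite (hpart_0 dD (kE : ~ [set _] k) Ca) gact0r (hpart_0 dV _ Cxa)//=.
by move=> E; apply: kE; rewrite -E gcompVK.
Qed.

(** The components of degree [(g i)^-1 h] of the coordinates are coordinates of
    [v] as well, so they are all of them. *)
Lemma coordinates_comp h v (a : 'I_n -> D) i : mcomp V h v -> tgt h = f ->
  coordinates v a -> rcomp D (gcomp (ginv (g i)) h) (a i).
Proof.
move=> Cv hf va; pose a' i := hpart dD [set gcomp (ginv (g i)) h] (a i).
have Ca' j : rcomp D (gcomp (ginv (g j)) h) (a' j).
  by rewrite /a' hpart1E; have [_ Cz _] := hcompP dD (a j).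
suff -> : a = a' by [].
apply: (coordinates_uniq va); split=> [j|].
  have := gone_mul (Ca' j); rewrite tgt_comp ?src_inv ?basis_tgt// tgt_inv.
  exact.
rewrite -[LHS](hpart_id dV (erefl : [set h] h) Cv) {1}va.2.
rewrite (morphB_sum _ _ (hpartB dV _)); apply: eq_bigr => j _.
by rewrite gact_hpart.
Qed.

End FiberCoordinates.

Lemma exists_dual_basis : obj_finite_dim V ->
  exists (J : Type) (c : J -> G) (x : J -> V) (K : J -> V -> D),
    dual_basis c x K.
Proof.
move=> /choice[n nP].
pose x f := projT1 (cid (nP f)).
pose g f : 'I_(n f) -> G := projT1 (cid (projT2 (cid (nP f)))).
have bP f : pseudo_basis (fiber f) (x f) (g f) := projT2 (cid (projT2 (cid (nP f)))).
pose k f v := projT1 (cid (coordinates_exist (bP f) (@hpart_fiber f v))).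
have kP f v : coordinates (x f) (g f) (end_one f v) (k f v) :=
  projT2 (cid (coordinates_exist (bP f) (@hpart_fiber f v))).
have tgtE f i : tgt (g f i) = f := basis_tgt (bP f) i.
have Cx f i : mcomp V (g f i) (x f i) by have [/(_ i)[_ +] _ _] := bP f.
have own f h v : mcomp V h v -> tgt h = f -> end_one f v = v.
  by move=> Cv hf; exact: (hpart_id dV (hf : [set g | tgt g = f] h) Cv).
have other f h v : mcomp V h v -> tgt h <> f -> end_one f v = 0.
  by move=> Cv hf; exact: (hpart_0 dV (hf : ~ [set g | tgt g = f] h) Cv).
have k0 f v : end_one f v = 0 -> k f v = fun=> 0.
  move=> v0; apply: (coordinates_uniq (bP f) (kP f v)); rewrite v0; split.
    by move=> i; exact: gmul0r.
  by rewrite big1// => i _; exact: gact0r.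
pose J := {f : obj G & 'I_(n f)}.
exists J, (fun j => g (tag j) (tagged j)), (fun j => x (tag j) (tagged j)),
  (fun j v => k (tag j) v (tagged j)).
split.
- by move=> [f i]; exact: Cx.
- by move=> [f i] /=; have [/(_ i)[+ _] _ _] := bP f.
- move=> [f i] v w /=; have := coordinatesB (kP f v) (kP f w).
  rewrite /end_one -hpartB => /(coordinates_uniq (bP f) (kP f (v - w))) ->.
  by [].
- move=> [f i] v a /=; have := coordinatesZ a (kP f v).
  have [_ <- _ _] := end_one_comp V f.
  by move=> /(coordinates_uniq (bP f) (kP f (gact v a))) ->.
- move=> [f i] h v Cv /=; rewrite tgtE => hf.
  by have := kP f v; rewrite (own f h)//; exact: coordinates_comp.
- by move=> [f i] h v Cv /=; rewrite tgtE => hf; rewrite k0//; exact: other Cv hf.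
- move=> [f i] /=; have := kP f (x f i); rewrite (own f _ _ (Cx f i))// => kx.
  by rewrite (coordinates_uniq (bP f) kx (coordinates_basis (bP f) i)) eqxx.
- move=> [f i] [f' i'] ij /=.
  have [ff|ff] := pselect (f = f'); last first.
    by rewrite k0// (other f _ _ (Cx f' i'))// tgtE => E; apply: ff.
  subst f'; have := kP f (x f i'); rewrite (own f _ _ (Cx f i'))// => kx.
  rewrite (coordinates_uniq (bP f) kx (coordinates_basis (bP f) i')).
  by case: eqP => // ii; case: ij; rewrite ii.
- move=> f; exists (n f), (fun i => existT _ f i); split=> //.
  + by move=> i j; exact: (@eq_from_Tagged {classic (obj G)}).
  + by move=> v; have [_ ->] := kP f v.
Qed.

End Modules.

Lemma end_ring_frame (G : groupoid) (D : grRing G) (V : grMod D) :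
  gr_division D -> gr_prime D -> (exists v : V, v <> 0) -> obj_finite_dim V ->
  has_division_frame (end_ring V).
Proof.
move=> divD pD [v v0] /exists_dual_basis[J [c [x [K bV]]]].
suff [j] : inhabited J.
  exact: (units_frame _ (end_matrix_units bV) divD (gr_prime_elementwise pD) j).
have [h [w [_ Cw w0]]] := graded_homogeneous (graded_setT (mcomp_direct V)) (I : setT v) v0.
have [_ _ _ _ _ _ _ _ /(_ (tgt h))[n [s [_ _ sP]]]] := bV.
case: n s sP => [s sP|n s _]; last by split; exact: s ord0.
case: w0; rewrite -(hpart_id (mcomp_direct V) (erefl : [set g | tgt g = tgt h] h) Cw).
by have := sP w; rewrite big_ord0.
Qed.

(** * Realizing a ring with a frame *)

Section Corner.
Variables (G : groupoid) (R : grRing G) (e : obj G) (eps : R).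
Hypothesis divE : division_corner e eps.
Implicit Types (a b r : R) (g h c : G).

Let Ce : rcomp R (idn e) eps. Proof. by case: divE. Qed.
Let eps0 : eps <> 0. Proof. by case: divE. Qed.
Let epsI : gmul eps eps = eps. Proof. by case: divE. Qed.

Definition corner_comp g : set R :=
  [set a | [/\ rcomp R g a, gmul eps a = a & gmul a eps = a]].

Definition corner_one (f : obj G) : R := if pselect (f = e) then eps else 0.

Lemma corner_laws : gr_laws corner_comp gmul corner_one.
Proof.
have [RC RI _] := rcomp_direct R.
have one_loop f : f <> e -> corner_one f = 0.
  by rewrite /corner_one; case: pselect.
have oneE : corner_one e = eps by rewrite /corner_one; case: pselect.
split.
- move=> g; split=> [|a b [Ca ea ae] [Cb eb be]].
    by split; rewrite ?gmul0r ?gmul0l//; exact: rcomp0.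
  by split; [exact: rcompB|rewrite gmulBr ea eb|rewrite gmulBl ae be].
- by move=> a fa Ca a0; apply: RI => // g; have [] := Ca g.
- by move=> *; exact: gmulA.
- by move=> *; exact: gmulDl.
- by move=> *; exact: gmulDr.
- move=> g h a b gh [Ca ea _] [Cb _ be]; split; first exact: rcompM.
    by rewrite gmulA ea.
  by rewrite -gmulA be.
- by move=> g h a b gh [Ca _ _] [Cb _ _]; exact: rcompM0 gh Ca Cb.
- move=> f; have [->|fe] := pselect (f = e); first by rewrite oneE.
  by rewrite one_loop//; split; rewrite ?gmul0r ?gmul0l//; exact: rcomp0.
- move=> g a [Ca ea _]; have [->|ge] := pselect (tgt g = e); first by rewrite oneE.
  rewrite one_loop// gmul0l -ea (rcompM0 _ Ce Ca)// src_idn => eg.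
  by apply: ge.
- move=> g a [Ca _ ae]; have [->|ge] := pselect (src g = e); first by rewrite oneE.
  by rewrite one_loop// gmul0r -ae (rcompM0 _ Ca Ce)// tgt_idn.
Qed.

Definition corner_ring : grRing G := gr_span corner_laws.

Lemma corner_valP (d : corner_ring) :
  gmul eps (val d) = val d /\ gmul (val d) eps = val d.
Proof.
have /span_predP := valP d; move: (val d).
apply: (addspan_ind (P := [set a | gmul eps a = a /\ gmul a eps = a])) => [|a [g _ []]//].
split=> [|a b [ea ae] [eb be]]; first by rewrite /= gmul0l gmul0r.
by rewrite /= gmulBl gmulBr ea ae eb be.
Qed.

Lemma corner_projB : {morph (fun a => gmul (gmul eps a) eps) : a b / a - b}.
Proof. by move=> a b; rewrite gmulBr gmulBl. Qed.

Lemma corner_proj_comp g a :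
  rcomp R g a -> corner_comp g (gmul (gmul eps a) eps).
Proof.
move=> Ca; split; last by rewrite -gmulA epsI.
  by apply: (rcomp_idr Ce); exact: (rcomp_idl Ce).
by rewrite !gmulA epsI.
Qed.

Definition corner_proj a : corner_ring :=
  SpanT (introT (span_predP _ _) (span_image corner_projB corner_proj_comp a)).

Lemma corner_projE a : gmul eps a = a -> gmul a eps = a -> val (corner_proj a) = a.
Proof. by move=> ea ae /=; rewrite ea ae. Qed.

Lemma corner_val_inj (d d' : corner_ring) : val d = val d' -> d = d'.
Proof. exact: val_inj. Qed.

Lemma corner_mulE (d d' : corner_ring) : val (gmul d d') = gmul (val d) (val d').
Proof. by []. Qed.

Lemma corner_val_sum (I : Type) (r : seq I) (F : I -> corner_ring) :
  val (\sum_(i <- r) F i) = \sum_(i <- r) val (F i).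
Proof. exact: raddf_sum. Qed.

Lemma corner_oneE : val (gone corner_ring e) = eps.
Proof. by rewrite /= /corner_one; case: pselect. Qed.

Lemma corner_division : gr_division corner_ring.
Proof.
have [_ _ _ inv] := divE.
split.
  by exists (corner_proj eps) => /(congr1 val) /=; rewrite !epsI.
move=> g d Cd d0; have [Cg ed de] : corner_comp g (val d) := Cd.
have v0 : val d <> 0 by move=> v0; apply: d0; exact: corner_val_inj.
have [tg sg] := corner_degree divE Cg v0 ed de.
have [b [Cb eb be db bd]] := inv g _ Cg ed de v0.
have bE := corner_projE eb be.
exists (corner_proj b); split.
- exact: (corner_proj_comp Cb).
- apply: corner_val_inj; by rewrite corner_mulE bE db tg corner_oneE.
- apply: corner_val_inj; by rewrite corner_mulE bE bd sg corner_oneE.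
Qed.

Lemma corner_supp : supp corner_ring `<=` corner e e.
Proof.
move=> g Dg; have [d [Cd d0]] : exists d, rcomp corner_ring g d /\ d <> 0.
  apply: contrapT => n; apply: Dg; apply/seteqP; split=> [d Cd|_ ->].
    by apply: contrapT => d0; apply: n; exists d.
  exact: rcomp0.
have [Cg ed de] : corner_comp g (val d) := Cd.
apply: (corner_degree divE Cg) => // v0.
by apply: d0; exact: corner_val_inj.
Qed.

Section Realization.
Variables (n : obj G -> nat) (g : forall f, 'I_(n f) -> G).
Variables (x y : forall f, 'I_(n f) -> R).
Hypothesis sys : forall f, complete_system eps e f (@g f) (@x f) (@y f).

Let gef f (i : 'I_(n f)) : src (g i) = e /\ tgt (g i) = f.
Proof. by have [[/(_ i)]] := sys f. Qed.
Let Cx f (i : 'I_(n f)) : rcomp R (g i) (x i) /\ gmul (x i) eps = x i.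
Proof. by have [[_ /(_ i)]] := sys f. Qed.
Let Cy f (i : 'I_(n f)) : rcomp R (ginv (g i)) (y i) /\ gmul eps (y i) = y i.
Proof. by have [[_ _ /(_ i)]] := sys f. Qed.
Let yx f (i j : 'I_(n f)) : gmul (y i) (x j) = if i == j then eps else 0.
Proof. by have [[_ _ _ /(_ i j)]] := sys f. Qed.

Lemma dual_off f f' (i : 'I_(n f)) (j : 'I_(n f')) : f <> f' ->
  gmul (y i) (x j) = 0.
Proof.
by move=> ff; apply: rcompM0 (Cy i).1 (Cx j).1; rewrite src_inv !(gef _).2.
Qed.

(** ** As a matrix ring *)

Definition index := {f : obj G & 'I_(n f)}.

Definition shift (j : index) : G := ginv (g (tagged j)).

Lemma shift_tgt j : tgt (shift j) = e.
Proof. by rewrite tgt_inv (gef _).1. Qed.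

Lemma shift_src j : src (shift j) = tag j.
Proof. by rewrite src_inv (gef _).2. Qed.

Lemma finite_index f : finite_set [set j : index | tag j = f].
Proof.
apply: (sub_finite_set _ (finite_image (existT (fun f => 'I_(n f)) f) (@finite_finset _ setT))).
by move=> [f' i] /= ff; subst f'; exists i.
Qed.

Lemma shift_finite : d_finite shift.
Proof.
by move=> f; apply: sub_finite_set (finite_index f) => j /=; rewrite shift_src.
Qed.

Lemma fsum_index (A : zmodType) f (a : index -> A) :
  (forall j, tag j <> f -> a j = 0) ->
  fsum a = \sum_(i < n f) a (existT _ f i).
Proof.
move=> a0; pose F (i : 'I_(n f)) : {classic index} := existT (fun f => 'I_(n f)) f i.
have Finj : injective F by move=> i j; exact: (@eq_from_Tagged {classic (obj G)}).
rewrite (@fsumE _ _ a [seq F i | i <- enum 'I_(n f)]).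
- by rewrite big_map big_enum.
- by rewrite map_inj_uniq// enum_uniq.
- move=> [f' i] ai; have ff : f' = f by apply: contrapT => /(a0 (existT _ f' i)).
  by subst f'; apply: map_f; rewrite mem_enum.
Qed.

Definition entry r (i j : index) : corner_ring :=
  corner_proj (gmul (gmul (y (tagged i)) r) (x (tagged j))).

Lemma entryE r i j :
  val (entry r i j) = gmul (gmul (y (tagged i)) r) (x (tagged j)).
Proof. by apply: corner_projE; rewrite ?gmulA ?(Cy _).2// -!gmulA (Cx _).2. Qed.

Lemma entry_tag c r i j : rcomp R c r -> entry r i j <> 0 ->
  tag i = tgt c /\ tag j = src c.
Proof.
move=> Cr r0.
have nz : gmul (gmul (y (tagged i)) r) (x (tagged j)) <> 0.
  by rewrite -entryE => E; apply: r0; exact: corner_val_inj.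
split; apply: contrapT => ne; apply: nz.
  rewrite (rcompM0 _ (Cy (tagged i)).1 Cr) ?gmul0l//.
  by rewrite src_inv (gef _).2.
rewrite -gmulA (rcompM0 _ Cr (Cx (tagged j)).1) ?gmul0r//.
by rewrite (gef _).2 => E; apply: ne.
Qed.

(** Multiplicativity of [entry] is the decomposition
    [r = \sum_k r x k y k] over the source of the degree of [r]; only the
    indices over that object contribute to the matrix product. *)
Lemma iso_mx_ring : gr_iso R
  (mx_ring (matricial_singletons corner_division corner_supp shift_tgt shift_finite)).
Proof.
apply: (gr_iso_span _ (F := entry)).
- move=> r s; apply/funext => i; apply/funext => j; apply: corner_val_inj.
  by rewrite entryE gmulBr gmulBl -!entryE.
- move=> c r Cr; split.
    apply: (sub_finite_set _ (finite_setX (finite_index (tgt c)) (finite_index (src c)))).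
    by move=> [i j] /= /(entry_tag Cr).
  move=> i j; have [->|ne] := pselect (entry r i j = 0); first by left.
  have [ti tj] := entry_tag Cr ne.
  right; exists (shift i), (shift j); split; rewrite ?shift_src//.
  split; last 2 first.
  + by rewrite entryE !gmulA (Cy _).2.
  + by rewrite entryE -!gmulA (Cx _).2.
  rewrite entryE /shift ginvK; apply: rcompM (Cx _).1.
    by rewrite src_comp ?src_inv (gef _).2.
  by apply: rcompM (Cy _).1 Cr; rewrite src_inv (gef _).2.
- move=> c d r s Cr Cs; apply/funext => i; apply/funext => l.
  rewrite /mx_mul (@fsum_index _ (src c)) => [|j tj]; last first.
    have [->|/(entry_tag Cr)[_ //]] := pselect (entry r i j = 0).
    exact: gmul0l.
  apply: corner_val_inj; rewrite entryE corner_val_sum.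
  rewrite {1}(expand_right (sys (src c)) Cr erefl).
  rewrite gmul_suml gmul_sumr gmul_suml; apply: eq_bigr => k _.
  by rewrite corner_mulE !entryE !gmulA.
- move=> c r Cr r0.
  rewrite (expand_left (sys (tgt c)) Cr erefl) big1// => i _.
  have -> : gmul (y i) r = 0; last exact: gmul0r.
  have Cyr := dual_left_comp (sys (tgt c)) i Cr erefl.
  have e1 : src (ginv (g i)) = tgt c by rewrite src_inv (gef _).2.
  rewrite (expand_right (sys (src c)) Cyr _) ?src_comp// big1// => j _.
  have := entryE r (existT _ (tgt c) i) (existT _ (src c) j).
  by rewrite r0 => <-; exact: gmul0l.
move=> c a [fa Ca].
pose aE k l := val (a (existT _ (tgt c) k) (existT _ (src c) l)).
exists (\sum_k \sum_l gmul (gmul (x k) (aE k l)) (y l)).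
apply/funext => i; apply/funext => j; apply: corner_val_inj; rewrite entryE.
have [[ti tj]|nt] := pselect (tag i = tgt c /\ tag j = src c); last first.
  have -> : a i j = 0.
    have [//|[_ [_ [-> -> sc tc _]]]] := Ca i j.
    by case: nt; rewrite -!shift_src.
  rewrite gmul_sumr gmul_suml big1// => k _; rewrite gmul_sumr gmul_suml big1// => l _.
  have [ti|ti] := pselect (tag i = tgt c); last first.
    by rewrite !gmulA (dual_off _ k ti) !gmul0l.
  rewrite -!gmulA dual_off ?gmul0r// => E; by apply: nt; split.
case: i j ti tj => [f i] [f' j] /= ti tj; subst f f'.
rewrite gmul_sumr gmul_suml (bigD1 i)//= [X in _ + X]big1 => [|k ki]; last first.
  rewrite gmul_sumr gmul_suml big1// => l _.
  by rewrite !gmulA yx eq_sym (negPf ki) !gmul0l.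
rewrite addr0 gmul_sumr gmul_suml (bigD1 j)//= big1 => [|l lj]; last first.
  by rewrite -!gmulA yx (negPf lj) !gmul0r.
rewrite addr0 !gmulA yx eqxx -gmulA yx eqxx.
by rewrite (corner_valP _).1 (corner_valP _).2.
Qed.

(** ** As an endomorphism ring *)

Definition col_comp c : set R := [set v | rcomp R c v /\ gmul v eps = v].

Definition col_type : zmodType := spanT (\bigcup_c col_comp c).

Lemma col_projB : {morph (fun a => gmul a eps) : a b / a - b}.
Proof. exact: gmulBl. Qed.

Lemma col_proj_comp c a : rcomp R c a -> col_comp c (gmul a eps).
Proof. by move=> Ca; split; [exact: (rcomp_idr Ce)|rewrite -gmulA epsI]. Qed.

Definition col a : col_type :=
  SpanT (introT (span_predP _ _) (span_image col_projB col_proj_comp a)).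

Lemma colB : {morph col : a b / a - b}.
Proof. by move=> a b; apply: val_inj; exact: gmulBl. Qed.

Lemma col_valP (v : col_type) : gmul (val v) eps = val v.
Proof.
have /span_predP := valP v; move: (val v).
apply: (addspan_ind (P := [set a | gmul a eps = a])) => [|a [c _ []]//].
split=> [|a b ae be]; first by rewrite /= gmul0l.
by rewrite /= gmulBl ae be.
Qed.

Lemma colE a : gmul a eps = a -> val (col a) = a.
Proof. by []. Qed.

Lemma col_val_inj (v w : col_type) : val v = val w -> v = w.
Proof. exact: val_inj. Qed.

Lemma col_val_sum (I : Type) (r : seq I) (F : I -> col_type) :
  val (\sum_(i <- r) F i) = \sum_(i <- r) val (F i).
Proof. exact: raddf_sum. Qed.

Lemma colK (v : col_type) : col (val v) = v.
Proof. by apply: val_inj; exact: col_valP. Qed.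

Definition col_act (v : col_type) (d : corner_ring) : col_type :=
  col (gmul (val v) (val d)).

Lemma col_actE v d : val (col_act v d) = gmul (val v) (val d).
Proof. by apply: colE; rewrite -gmulA (corner_valP d).2. Qed.

Definition col_mcomp c : set col_type := [set v | rcomp R c (val v)].

Lemma col_direct : direct_sum col_mcomp.
Proof.
have [RC RI _] := rcomp_direct R.
split.
- move=> c; split=> [|v w Cv Cw]; first exact: rcomp0.
  exact: rcompB.
- move=> a fa Ca a0 c; apply: val_inj.
  apply: (RI (fun c => val (a c))) => //.
    by apply: sub_finite_set fa => c' /= ac' E; apply: ac'; rewrite E.
  have [s [us sa]] := finite_set_seq fa.
  rewrite (@fsumE _ _ _ s)//; last by move=> t at0; apply: sa => /= E; rewrite E in at0.
  by rewrite -raddf_sum -(@fsumE _ _ a s)// a0.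
- apply/seteqP; split=> // v _; rewrite -(colK v).
  apply: (span_image colB) => c r Cr; exact: (col_proj_comp Cr).1.
Qed.

Lemma col_unit (v : col_type) : col_act v (corner_proj eps) = v.
Proof. by apply: col_val_inj; rewrite col_actE /= !epsI col_valP. Qed.

Lemma col_actA v (d d' : corner_ring) :
  col_act (col_act v d) d' = col_act v (gmul d d').
Proof. by apply: col_val_inj; rewrite !col_actE -gmulA. Qed.

Lemma col_actDl v w d : col_act (v + w) d = col_act v d + col_act w d.
Proof. by apply: col_val_inj; rewrite col_actE [LHS]gmulDl -!col_actE. Qed.

Lemma col_actDr v (d d' : corner_ring) :
  col_act v (d + d') = col_act v d + col_act v d'.
Proof. by apply: col_val_inj; rewrite col_actE [LHS]gmulDr -!col_actE. Qed.

Lemma col_actM c h v d : src c = tgt h -> col_mcomp c v ->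
  rcomp corner_ring h d -> col_mcomp (gcomp c h) (col_act v d).
Proof.
move=> ch Cv [Cd _ _].
rewrite -[col_mcomp _ _]/(rcomp R (gcomp c h) (val (col_act v d))) col_actE.
exact: (rcompM ch Cv Cd).
Qed.

Lemma col_actM0 c h v d : src c <> tgt h -> col_mcomp c v ->
  rcomp corner_ring h d -> col_act v d = 0.
Proof.
move=> ch Cv [Cd _ _]; apply: col_val_inj; rewrite col_actE.
exact: (rcompM0 ch Cv Cd).
Qed.

Lemma col_full : addspan [set col_act v d | v in [set: col_type] &
  d in [set: corner_ring]] = setT.
Proof.
apply/seteqP; split=> // v _; apply: addspan_sub.
by exists v => //; exists (corner_proj eps) => //; exact: col_unit.
Qed.

(** The left ideal [R eps] as a right module over [eps R eps]. *)
Definition column : grMod corner_ring :=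
  GrMod col_actA col_actDl col_actDr col_direct col_actM col_actM0 col_full.

Definition column_basis f (i : 'I_(n f)) : column := col (x i).

Lemma column_basisE f (i : 'I_(n f)) : val (column_basis i) = x i.
Proof. exact: (Cx i).2. Qed.

Lemma column_expand f h (v : column) : mcomp column h v -> tgt h = f ->
  v = \sum_(i < n f) gact (column_basis i) (corner_proj (gmul (y i) (val v))).
Proof.
move=> Cv hf; apply: col_val_inj; rewrite col_val_sum.
rewrite {1}(expand_left (sys f) Cv hf); apply: eq_bigr => i _.
rewrite [RHS]col_actE column_basisE corner_projE//.
  by rewrite gmulA (Cy i).2.
by rewrite -gmulA col_valP.
Qed.

Lemma column_finite_dim : obj_finite_dim column.
Proof.
move=> f; exists (n f), (@column_basis f), (@g f); split.
- move=> i; split=> [|]; last by rewrite /= /col_mcomp /= (Cx i).2; exact: (Cx i).1.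
  move=> /(congr1 val); rewrite column_basisE => x0; apply: eps0.
  by have := yx i i; rewrite eqxx x0 gmul0r.
- apply/seteqP; split; last first.
    move=> v; apply; split=> [|_ [i _ <-]]; first exact: fiber_submodule.
    apply: addspan_sub; exists (g i); first exact: (gef i).2.
    by rewrite /= /col_mcomp /= (Cx i).2; exact: (Cx i).1.
  apply: addspan_ind => [|v [h /= hf Cv]].
    split=> [S [[[S0 _] _] _] //|v w Sv Sw S SS].
    by have [[[_ SB] _] _] := SS; apply: SB; [exact: Sv|exact: Sw].
  rewrite (column_expand Cv hf) => S [[sS Sa] Sx].
  by apply: subgroup_sum => // i; apply: Sa; apply: Sx; exists i.
- move=> a _ _; rewrite fsum_ord => /(congr1 val); rewrite col_val_sum => E i.
  apply: corner_val_inj; rewrite -[RHS]/(0 : R).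
  have := congr1 (gmul (y i)) E; rewrite gmul0r => <-.
  have coordE j : gmul (y i) (val (gact (column_basis j) (a j))) =
      gmul (gmul (y i) (x j)) (val (a j)).
    by rewrite [X in gmul _ X]col_actE column_basisE gmulA.
  rewrite gmul_sumr (bigD1 i isT) big1 => [|j /= ji]; last first.
    by rewrite coordE yx eq_sym (negPf ji) gmul0l.
  by rewrite [RHS]addr0 coordE yx eqxx (corner_valP _).1.
Qed.

Lemma column_neq0 : exists v : column, v <> 0.
Proof. by exists (col eps) => /(congr1 val) /=; rewrite epsI. Qed.

Definition left_mul r : column -> column := fun v => col (gmul r (val v)).

Lemma left_mulE r v : val (left_mul r v) = gmul r (val v).
Proof. by apply: colE; rewrite -gmulA col_valP. Qed.

(** An endomorphism [phi] of degree [c] is determined on [1_(src c) V], where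
    [v = \sum_k x k (y k v)] with [y k v] in the corner; so [phi] is left
    multiplication by [\sum_k phi (x k) y k]. *)
Lemma iso_end_ring : gr_iso R (end_ring column).
Proof.
apply: (gr_iso_span _ (F := left_mul)).
- move=> r s; apply/funext => v; apply: col_val_inj.
  by rewrite left_mulE gmulBl -!left_mulE.
- move=> c r Cr; split=> [v w|v d|h v ch Cv|h v ch Cv].
  + by apply: col_val_inj; rewrite left_mulE [LHS]gmulDr -!left_mulE.
  + apply: col_val_inj; rewrite left_mulE [RHS]col_actE.
    by rewrite [X in gmul r X]col_actE left_mulE gmulA.
  + rewrite -[mcomp _ _ _]/(rcomp R (gcomp c h) (val (left_mul r v))) left_mulE.
    exact: (rcompM ch Cr Cv).
  + by apply: col_val_inj; rewrite left_mulE; exact: (rcompM0 ch Cr Cv).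
- move=> c d r s _ _; apply/funext => v; apply: col_val_inj.
  by rewrite -[RHS]/(val (left_mul r (left_mul s v))) !left_mulE gmulA.
- move=> c r Cr r0; rewrite (expand_right (sys (src c)) Cr erefl) big1// => i _.
  by rewrite -(column_basisE i) -left_mulE r0 gmul0l.
move=> c phi [phiD phiZ phiC phi0].
exists (\sum_(k < n (src c)) gmul (val (phi (column_basis k))) (y k)).
have phiB : {morph phi : v w / v - w} by exact: add_morphB.
apply/funext; apply: (direct_ext (mcomp_direct column)) => // [v w|h v Cv].
  by apply: col_val_inj; rewrite left_mulE [LHS]gmulBr -!left_mulE.
have [ch|ch] := pselect (src c = tgt h); last first.
  rewrite (phi0 h v ch Cv); apply: col_val_inj; rewrite left_mulE gmul_suml big1// => k _.
  rewrite -gmulA (rcompM0 _ (Cy k).1 Cv) ?gmul0r// src_inv (gef k).2.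
  exact: ch.
rewrite {2}(column_expand Cv (esym ch)) (morphB_sum _ _ phiB).
apply: col_val_inj; rewrite col_val_sum left_mulE gmul_suml; apply: eq_bigr => k _.
rewrite phiZ [RHS]col_actE corner_projE ?gmulA ?(Cy k).2//.
by rewrite -gmulA col_valP.
Qed.

End Realization.
End Corner.

(** * The equivalence *)

Section FrameRealization.
Variables (G : groupoid) (R : grRing G).
Hypothesis frameR : has_division_frame R.

Lemma frame_family : exists (e : obj G) (eps : R) (n : obj G -> nat)
    (g : forall f, 'I_(n f) -> G) (x y : forall f, 'I_(n f) -> R),
  division_corner e eps /\ forall f, complete_system eps e f (@g f) (@x f) (@y f).
Proof.
have [e [eps [divE full]]] := frameR.
have [n nP] := choice full.
pose g f := projT1 (cid (nP f)).
pose x f := projT1 (cid (projT2 (cid (nP f)))).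
pose y f := projT1 (cid (projT2 (cid (projT2 (cid (nP f)))))).
exists e, eps, n, g, x, y; split=> // f.
exact: (projT2 (cid (projT2 (cid (projT2 (cid (nP f))))))).
Qed.

Lemma frame_matrix_ring : exists (e : obj G) (D : grRing G) (I : Type)
    (sg : I -> G) (divD : gr_division D) (suppD : supp D `<=` corner e e)
    (sg_e : forall i, tgt (sg i) = e) (fin_sg : d_finite sg),
  inhabited I /\
  gr_iso R (mx_ring (matricial_singletons divD suppD sg_e fin_sg)).
Proof.
have [e [eps [n [g [x [y [divE sys]]]]]]] := frame_family.
exists e, (corner_ring divE), (index n), (shift g), (corner_division divE).
exists (@corner_supp _ _ _ _ divE), (shift_tgt sys), (shift_finite sys).
split; last exact: iso_mx_ring.
have [[Ce eps0 _ _] [_ sE]] := (divE, sys e).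
case E : (n e) => [|m].
  case: eps0; rewrite -(gone_mul Ce) tgt_idn -sE big1 ?gmul0l// => i _.
  by exfalso; move: i; rewrite E => -[].
by split; exists e; rewrite E; exact: ord0.
Qed.

Lemma frame_endomorphism_ring : exists (D : grRing G) (V : grMod D),
  [/\ gr_division D, exists e : obj G, supp D `<=` corner e e,
      exists v : V, v <> 0, obj_finite_dim V & gr_iso R (end_ring V)].
Proof.
have [e [eps [n [g [x [y [divE sys]]]]]]] := frame_family.
exists (corner_ring divE), (column divE); split.
- exact: corner_division.
- by exists e; exact: corner_supp.
- exact: column_neq0.
- exact: column_finite_dim sys.
- exact: iso_end_ring sys.
Qed.

End FrameRealization.

Theorem theorem5p23 (G : groupoid) (R : grRing G) :
  [<-> gr_simple R /\ obj_artinian R;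

       exists (e : obj G) (D : grRing G) (I : Type) (sg : I -> G)
              (divD : gr_division D) (suppD : supp D `<=` corner e e)
              (sg_e : forall i, tgt (sg i) = e) (fin_sg : d_finite sg),
         inhabited I /\
         gr_iso R (mx_ring (matricial_singletons divD suppD sg_e fin_sg));

       exists (D : grRing G) (I : Type) (Sg : I -> set G)
              (matSg : matricial D Sg),
         [/\ gr_division D, gr_prime D, inhabited I &
             gr_iso R (mx_ring matSg)];

       exists (D : grRing G) (V : grMod D),
         [/\ gr_division D, exists e : obj G, supp D `<=` corner e e,
             exists v : V, v <> 0, obj_finite_dim V &
             gr_iso R (end_ring V)];

       exists (D : grRing G) (V : grMod D),
         [/\ gr_division D, gr_prime D,
             exists v : V, v <> 0, obj_finite_dim V &
             gr_iso R (end_ring V)]].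
Proof.
tfae.
- by move=> [sR aR]; exact: frame_matrix_ring (simple_artinian_frame sR aR).
- move=> [e [D [I [sg [divD [De [sg_e [fin_sg [inhI isoR]]]]]]]]].
  exists D, I, (fun i => [set sg i]), (matricial_singletons divD De sg_e fin_sg).
  by split=> //; exact: (corner_division_prime divD De).
- move=> [D [I [Sg [mSg [divD pD inhI isoR]]]]].
  exact: frame_endomorphism_ring (frame_iso isoR (mx_ring_frame mSg divD pD inhI)).
- move=> [D [V [divD [e De] V0 finV isoR]]].
  by exists D, V; split=> //; exact: (corner_division_prime divD De).
- move=> [D [V [divD pD V0 finV isoR]]].
  exact: frame_simple_artinian (frame_iso isoR (end_ring_frame divD pD V0 finV)).
Qed.
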